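(* Let $K$ be a field, $R=K[x_1,\dots,x_n]$, let $\Gamma$ be a simple graph on the vertex set $V=\{1,\dots,n\}$ and let $I=I(\Gamma)$ be its edge ideal. Let $\mathbf a\in\mathbb N^n$. Then $x^{\mathbf a}\in \widetilde{I^4}\setminus I^4$ if and only if $V_{\mathbf a}$ is a dominating set of $\Gamma$ and one of the following conditions is satisfied: (i) $\Gamma_{\mathbf a}$ is (with all weights one) the disjoint union of a triangle and a $K_4$ (Type S7 of the context), such that every $i\in V\setminus V_{\mathbf a}$ is adjacent in $\Gamma$ either to the triangle or to every triangle of the $K_4$; (ii) $\Gamma_{\mathbf a}$ is (with all weights one) spanned by two disjoint triangles connected by a path of length 2 (Type S12 of the context), such that either the endpoints of the path are adjacent in $\Gamma_{\mathbf a}$ or every vertex in $V\setminus V_{\mathbf a}$ is adjacent in $\Gamma$ to at least one of the two triangles; (iii) $\Gamma_{\mathbf a}$ belongs to one of the Types S1–S6, S8–S11, S13 or to one of the Types W1–W10 of the context, and $\deg_{\mathbf a}(i) > 7-\deg(x^{\mathbf a})$ for every $i\in V\setminus V_{\mathbf a}$.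
   Context: $\mathbb N$ includes $0$; for $\mathbf a=(a_1,\dots,a_n)\in\mathbb N^n$, $x^{\mathbf a}=x_1^{a_1}\cdots x_n^{a_n}$ and $\deg(x^{\mathbf a})=a_1+\cdots+a_n$. The edge ideal $I(\Gamma)$ is generated by the monomials $x_ix_j$ with $\{i,j\}$ an edge of $\Gamma$. For an ideal $Q$ of $R$, $\widetilde Q=\bigcup_{k\ge 1}(Q:(x_1,\dots,x_n)^k)$ is its saturation. A set $U\subseteq V$ is dominating if every vertex of $\Gamma$ is adjacent to some vertex of $U$. A vertex is said to be adjacent to a triangle if it is adjacent to at least one of the vertices of the triangle. A weighted graph is a finite simple graph (its base) with a positive integer weight on every vertex. Simple graphs are regarded as weighted graphs with all weights one. Given $\mathbf a$, set $V_{\mathbf a}=\{i: a_i>0\}$; $\Gamma_{\mathbf a}$ is the weighted graph whose base is the induced subgraph of $\Gamma$ on $V_{\mathbf a}$ and where $i\in V_{\mathbf a}$ has weight $a_i$. For $i\in V$, $\deg_{\mathbf a}(i)=\sum a_j$, the sum being over all $j\in V_{\mathbf a}$ adjacent to $i$ in $\Gamma$. ''$\Omega$ is spanned by $H$'' means that $H$ is a subgraph of (the base of) $\Omega$ with the same vertex set (extra edges are allowed). Vertices whose weight is not specified have weight 1. ''Meeting at a vertex'' means sharing exactly that vertex. Types with trivial weights (all weights one): S1: $\Omega$ is $K_5$. S2: $\Omega$ is spanned by a cone on a 5-cycle (a 5-cycle plus a sixth vertex joined to all its vertices). S3: $\Omega$ is spanned by a union of four triangles: six vertices $i,j,p,q,u,v$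 and the triangles $\{i,p,q\},\{j,p,q\},\{i,u,v\},\{j,u,v\}$. S4: $\Omega$ is spanned by a triangular prism. S5: $\Omega$ is a disjoint union (no edges between the parts) of a triangle and a graph spanned by a 5-cycle $C_5$. S6: $\Omega$ is a disjoint union of a triangle and a graph spanned by two triangles meeting at a vertex. S7: $\Omega$ is a disjoint union of a triangle and a $K_4$. S8: $\Omega$ is spanned by a 7-cycle $C_7$. S9: $\Omega$ is spanned by a union of a triangle and a pentagon meeting at a vertex. S10: $\Omega$ is spanned by a union of two pentagons sharing a path of length 2 (exactly; 7 vertices). S11: $\Omega$ is spanned by a union of three triangles meeting at one common vertex (7 vertices). S12: $\Omega$ is spanned by two disjoint triangles connected by a path of length 2 (one endpoint of the path in each triangle, the midpoint outside both; 7 vertices). S13: $\Omega$ is a disjoint union of three triangles. Types with non-trivial weights: W1: $\Omega$ is a triangle with weights $(2,2,2)$, $(3,2,2)$ or $(3,3,1)$. W2: $\Omega$ is spanned by a union of a triangle $\{x,a,b\}$ and an edge $\{x,y\}$ (4 vertices) with one of the weightings: $x=3,y=2,a=b=1$; $x=3,a=2,b=y=1$; $x=a=b=2,y=1$. W3: $\Omega$ is spanned by a union of a triangle and two edges (5 vertices), namely one of: triangle $\{a,b,x\}$ with edges $\{x,u\},\{u,v\}$, where $x$ and $u$ have weight 2; triangle $\{x_1,x_2,z\}$ with edges $\{x_1,y_1\},\{x_2,y_2\}$, where $x_1$ and $x_2$ have weight 2; triangle $\{a,b,x\}$ with edges $\{x,y_1\},\{x,y_2\}$, where $x$ has weight 3.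 W4: $\Omega$ is spanned by a union of two triangles, namely one of: two triangles sharing exactly an edge, both of whose vertices have weight 2; two triangles meeting at a vertex of weight 2; two triangles meeting at a vertex of weight 2, with exactly one further vertex of weight 2; two triangles meeting at a vertex of weight 1, where the other two vertices of one of the triangles have weight 2. W5: $\Omega$ is spanned by a union of two triangles and an edge (6 vertices, exactly one vertex of weight 2), namely one of: two triangles meeting at a vertex $c$ of weight 2 and an edge from $c$ to a sixth vertex; two triangles meeting at a vertex and an edge joining a vertex $m\neq$ the common vertex, $m$ of weight 2, to a sixth vertex; two disjoint triangles joined by an edge one of whose endpoints has weight 2. W6: $\Omega$ is spanned by a pentagon with weights $(2,2,1,1,1)$ in cyclic order. W7: $\Omega$ is spanned by a union of a pentagon and an edge meeting at a vertex of weight 2 (6 vertices). W8: $\Omega$ is spanned by the union of a rectangle (4-cycle) and a triangle meeting at a vertex of weight 2 (6 vertices). W9: $\Omega$ is a disjoint union of a simple triangle (weights one) and a triangle with weights $(2,2,1)$. W10: $\Omega$ is a disjoint union of a simple triangle and a graph spanned by a triangle and an edge meeting at a vertex of weight 2 (4 vertices). *)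

(* Defs.v *)
From HB Require Import structures.
From mathcomp Require Export all_boot all_order all_algebra.
From mathcomp Require Export mpoly.

Set Implicit Arguments.
Unset Strict Implicit.
Unset Printing Implicit Defensive.

Import GRing.Theory.

Local Open Scope ring_scope.

Section Ideals.
Variable R : comNzRingType.
Implicit Types (S I J : R -> Prop) (p q : R).

Definition ideal_span S : R -> Prop := fun p =>
  exists2 s : seq (R * R),
    (forall c, c \in s -> S c.2) & p = \sum_(c <- s) c.1 * c.2.

Definition ideal_mul I J : R -> Prop :=
  ideal_span (fun p => exists f g, [/\ I f, J g & p = f * g]).

Fixpoint ideal_exp I (k : nat) : R -> Prop :=
  if k is k'.+1 then ideal_mul I (ideal_exp I k') else fun=> True.

Definition ideal_colon I J : R -> Prop := fun p =>
  forall q, J q -> I (p * q).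

End Ideals.

Section PolynomialIdeals.
Variables (K : fieldType) (n : nat).

Definition irrelevant_ideal : {mpoly K[n]} -> Prop :=
  ideal_span (fun p => exists i : 'I_n, p = 'X_i).

Definition saturation (Q : {mpoly K[n]} -> Prop) : {mpoly K[n]} -> Prop :=
  fun p => exists2 k : nat,
    (1 <= k)%N & ideal_colon Q (ideal_exp irrelevant_ideal k) p.

End PolynomialIdeals.

Local Open Scope nat_scope.

Record sgraph (T : finType) := SGraph {
  adj :> rel T;
  adj_sym : ssrbool.symmetric adj;
  adj_irr : irreflexive adj }.

Record wgraph (T : finType) := WGraph {
  base :> sgraph T;
  weight : T -> nat;
  weight_gt0 : forall x, 0 < weight x }.

Definition edge_ideal (K : fieldType) (n : nat) (G : sgraph 'I_n) :
    {mpoly K[n]} -> Prop :=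
  ideal_span (fun p => exists i j : 'I_n, G i j /\ p = ('X_i * 'X_j)%R).

(* Every vertex, including those of [U], must have a neighbour in [U]. *)
Definition dominating (T : finType) (G : sgraph T) (U : {set T}) : Prop :=
  forall i, exists2 j, j \in U & G i j.

Definition adjacent_to (T : finType) (G : sgraph T) (i : T) (s : seq T) : bool :=
  has (G i) s.

Section InducedWeightedGraph.
Variables (n : nat) (G : sgraph 'I_n) (a : 'X_{1..n}).

Definition posset : {set 'I_n} := [set i | 0 < a i].

Definition posvertex : finType := {i : 'I_n | i \in posset}.

Definition induced_adj : rel posvertex := fun x y => G (val x) (val y).

Lemma induced_adj_sym : ssrbool.symmetric induced_adj.
Proof. by move=> x y; apply: adj_sym. Qed.

Lemma induced_adj_irr : irreflexive induced_adj.
Proof. by move=> x; apply: adj_irr. Qed.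

Definition induced_weight (x : posvertex) : nat := a (val x).

Lemma induced_weight_gt0 x : 0 < induced_weight x.
Proof. by have := valP x; rewrite inE. Qed.

Definition induced_wgraph : wgraph posvertex :=
  WGraph (SGraph induced_adj_sym induced_adj_irr) induced_weight_gt0.

Definition neighbor_deg (i : 'I_n) : nat := \sum_(j in posset | G i j) a j.

End InducedWeightedGraph.

(* "[O] is spanned by H" is expressed by a listing [vs] of all the vertices of
   [O] together with the edges of H; unless stated otherwise (by [separated],
   or by [pairwise O] for complete graphs) further edges are allowed. *)
Section Types.
Variables (T : finType) (O : wgraph T).
Implicit Types (x y z : T) (vs : seq T).

Definition weighted_vertices vs (ws : seq nat) : Prop :=
  [/\ uniq vs, forall x, x \in vs & map (weight O) vs = ws].

Definition simple_vertices vs : Prop :=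
  weighted_vertices vs (nseq (size vs) 1).

Definition triangle x y z : bool := cycle O [:: x; y; z].

Definition separated (s t : seq T) : bool := allrel (fun x y => ~~ O x y) s t.

Definition typeS1 : Prop := exists v1 v2 v3 v4 v5,
  simple_vertices [:: v1; v2; v3; v4; v5] /\
  pairwise O [:: v1; v2; v3; v4; v5].

Definition typeS2 : Prop := exists x v1 v2 v3 v4 v5,
  [/\ simple_vertices [:: x; v1; v2; v3; v4; v5],
      cycle O [:: v1; v2; v3; v4; v5] & all (O x) [:: v1; v2; v3; v4; v5]].

Definition typeS3 : Prop := exists i j p q u v,
  simple_vertices [:: i; j; p; q; u; v] /\
  [/\ triangle i p q, triangle j p q, triangle i u v & triangle j u v].

Definition typeS4 : Prop := exists x1 x2 x3 y1 y2 y3,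
  simple_vertices [:: x1; x2; x3; y1; y2; y3] /\
  [/\ triangle x1 x2 x3, triangle y1 y2 y3, O x1 y1, O x2 y2 & O x3 y3].

Definition typeS5 : Prop := exists t1 t2 t3 c1 c2 c3 c4 c5,
  simple_vertices [:: t1; t2; t3; c1; c2; c3; c4; c5] /\
  [/\ triangle t1 t2 t3, cycle O [:: c1; c2; c3; c4; c5] &
      separated [:: t1; t2; t3] [:: c1; c2; c3; c4; c5]].

Definition typeS6 : Prop := exists t1 t2 t3 c p q u v,
  simple_vertices [:: t1; t2; t3; c; p; q; u; v] /\
  [/\ triangle t1 t2 t3, triangle c p q, triangle c u v &
      separated [:: t1; t2; t3] [:: c; p; q; u; v]].

Definition typeS7_on t1 t2 t3 k1 k2 k3 k4 : Prop :=
  simple_vertices [:: t1; t2; t3; k1; k2; k3; k4] /\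
  [/\ triangle t1 t2 t3, pairwise O [:: k1; k2; k3; k4] &
      separated [:: t1; t2; t3] [:: k1; k2; k3; k4]].

Definition typeS8 : Prop := exists v1 v2 v3 v4 v5 v6 v7,
  simple_vertices [:: v1; v2; v3; v4; v5; v6; v7] /\
  cycle O [:: v1; v2; v3; v4; v5; v6; v7].

Definition typeS9 : Prop := exists c p q v1 v2 v3 v4,
  [/\ simple_vertices [:: c; p; q; v1; v2; v3; v4],
      triangle c p q & cycle O [:: c; v1; v2; v3; v4]].

(* The shared path is x - y - z. *)
Definition typeS10 : Prop := exists x y z u1 u2 v1 v2,
  [/\ simple_vertices [:: x; y; z; u1; u2; v1; v2],
      cycle O [:: x; y; z; u1; u2] & cycle O [:: x; y; z; v1; v2]].

Definition typeS11 : Prop := exists c p1 q1 p2 q2 p3 q3,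
  simple_vertices [:: c; p1; q1; p2; q2; p3; q3] /\
  [/\ triangle c p1 q1, triangle c p2 q2 & triangle c p3 q3].

(* The connecting path is x - m - y. *)
Definition typeS12_on x x1 x2 m y y1 y2 : Prop :=
  simple_vertices [:: x; x1; x2; m; y; y1; y2] /\
  [/\ triangle x x1 x2, triangle y y1 y2, O x m & O m y].

Definition typeS13 : Prop := exists x1 x2 x3 y1 y2 y3 z1 z2 z3,
  [/\ simple_vertices [:: x1; x2; x3; y1; y2; y3; z1; z2; z3],
      [/\ triangle x1 x2 x3, triangle y1 y2 y3 & triangle z1 z2 z3] &
      [/\ separated [:: x1; x2; x3] [:: y1; y2; y3],
          separated [:: x1; x2; x3] [:: z1; z2; z3] &
          separated [:: y1; y2; y3] [:: z1; z2; z3]]].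

Definition typeW1 : Prop := exists x y z,
  [\/ weighted_vertices [:: x; y; z] [:: 2; 2; 2],
      weighted_vertices [:: x; y; z] [:: 3; 2; 2] |
      weighted_vertices [:: x; y; z] [:: 3; 3; 1]] /\
  triangle x y z.

Definition typeW2 : Prop := exists x a b y,
  [/\ [\/ weighted_vertices [:: x; a; b; y] [:: 3; 1; 1; 2],
          weighted_vertices [:: x; a; b; y] [:: 3; 2; 1; 1] |
          weighted_vertices [:: x; a; b; y] [:: 2; 2; 2; 1]],
      triangle x a b & O x y].

Definition typeW3 : Prop :=
  [\/ exists a b x u v,
        weighted_vertices [:: a; b; x; u; v] [:: 1; 1; 2; 2; 1] /\
        [/\ triangle a b x, O x u & O u v],
      exists x1 x2 z y1 y2,
        weighted_vertices [:: x1; x2; z; y1; y2] [:: 2; 2; 1; 1; 1] /\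
        [/\ triangle x1 x2 z, O x1 y1 & O x2 y2] |
      exists a b x y1 y2,
        weighted_vertices [:: a; b; x; y1; y2] [:: 1; 1; 3; 1; 1] /\
        [/\ triangle a b x, O x y1 & O x y2]].

Definition typeW4 : Prop :=
  (exists p q u v,
     [/\ weighted_vertices [:: p; q; u; v] [:: 2; 2; 1; 1],
         triangle p q u & triangle p q v]) \/
  (exists c p q u v,
     [/\ [\/ weighted_vertices [:: c; p; q; u; v] [:: 2; 1; 1; 1; 1],
             weighted_vertices [:: c; p; q; u; v] [:: 2; 2; 1; 1; 1] |
             weighted_vertices [:: c; p; q; u; v] [:: 1; 2; 2; 1; 1]],
         triangle c p q & triangle c u v]).

Definition typeW5 : Prop :=
  [\/ exists c p q u v y,
        weighted_vertices [:: c; p; q; u; v; y] [:: 2; 1; 1; 1; 1; 1] /\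
        [/\ triangle c p q, triangle c u v & O c y],
      exists c m q u v y,
        weighted_vertices [:: c; m; q; u; v; y] [:: 1; 2; 1; 1; 1; 1] /\
        [/\ triangle c m q, triangle c u v & O m y] |
      exists x x1 x2 y y1 y2,
        weighted_vertices [:: x; x1; x2; y; y1; y2] [:: 2; 1; 1; 1; 1; 1] /\
        [/\ triangle x x1 x2, triangle y y1 y2 & O x y]].

Definition typeW6 : Prop := exists v1 v2 v3 v4 v5,
  weighted_vertices [:: v1; v2; v3; v4; v5] [:: 2; 2; 1; 1; 1] /\
  cycle O [:: v1; v2; v3; v4; v5].

Definition typeW7 : Prop := exists x v2 v3 v4 v5 y,
  [/\ weighted_vertices [:: x; v2; v3; v4; v5; y] [:: 2; 1; 1; 1; 1; 1],
      cycle O [:: x; v2; v3; v4; v5] & O x y].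

Definition typeW8 : Prop := exists c v2 v3 v4 p q,
  [/\ weighted_vertices [:: c; v2; v3; v4; p; q] [:: 2; 1; 1; 1; 1; 1],
      cycle O [:: c; v2; v3; v4] & triangle c p q].

Definition typeW9 : Prop := exists t1 t2 t3 x y z,
  weighted_vertices [:: t1; t2; t3; x; y; z] [:: 1; 1; 1; 2; 2; 1] /\
  [/\ triangle t1 t2 t3, triangle x y z &
      separated [:: t1; t2; t3] [:: x; y; z]].

Definition typeW10 : Prop := exists t1 t2 t3 x p q y,
  weighted_vertices [:: t1; t2; t3; x; p; q; y] [:: 1; 1; 1; 2; 1; 1; 1] /\
  [/\ triangle t1 t2 t3, triangle x p q, O x y &
      separated [:: t1; t2; t3] [:: x; p; q; y]].

(* Types S7 and S12 are left out, as they come with their own conditions. *)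
Definition other_simple_type : Prop :=
  typeS1 \/ typeS2 \/ typeS3 \/ typeS4 \/ typeS5 \/ typeS6 \/
  typeS8 \/ typeS9 \/ typeS10 \/ typeS11 \/ typeS13.

Definition nontrivially_weighted_type : Prop :=
  typeW1 \/ typeW2 \/ typeW3 \/ typeW4 \/ typeW5 \/
  typeW6 \/ typeW7 \/ typeW8 \/ typeW9 \/ typeW10.

End Types.

(* Main.v *)
Require Import Defs.
From mathcomp Require Import zify.

Set Implicit Arguments.
Unset Strict Implicit.
Unset Printing Implicit Defensive.

(** A monomial [x^a] lies in [I^k] exactly when [k] edges, repetitions allowed, can
    be chosen that use each vertex [v] at most [a v] times ([packs], see
    [ideal_exp_packs]).  It lies in the saturation of [I^4] exactly when, for each
    vertex [i], four edges can be chosen once the capacity of [i] is raised by 4;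
    no larger raise can help, as four edges use [i] at most four times
    ([saturation_packs]).  The theorem thus describes the capacities [a] which do
    not pack four edges, but do so as soon as any one of them is raised
    ([obstructed], [obstructed_iff]).

    Let [a] be obstructed, let [M] be a maximum packing, and call residual the copies
    of vertices that [M] leaves unused.  Residual copies are pairwise nonadjacent,
    and by the alternating-path argument of [exchange] the four edges obtained by
    raising the capacity of a residual vertex [u] may be taken inside [M] and [u].
    Counting then shows that [M] has three edges, unless the degree of [x^a] is 5.
    Listing the ends of [M] and then the residual copies turns [a] into an ordinary
    graph on copies of vertices.  The possible graphs on 5, 6, 7, 8 or 9 copies
    are found by a finite search, carried out by computation: [search] follows a
    given decision tree, which splits on the adjacency of two copies; at a leaf
    either four disjoint edges are present, or the capacity of some copy can
    no longer be raised with success ([stuck]), or one of the wanted spanning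
    subgraphs is present ([embeds]).  Nine copies have to form three triangles
    without edges between them, and a tenth copy would then yield four disjoint
    edges, so the degree is at most 9.

    The search only yields spanning subgraphs in which every copy has weight one,
    but distinct copies may be copies of one vertex.  The weighted types appear in
    this way: when two nonadjacent vertices of a type are identified and
    their weights added, the result is again spanned by one of the types
    ([listed_shapes_closed], [special_shapes_closed]).

    For a vertex [i] outside the support of [a], four edges with the capacity of [i]
    raised use at least [8 - deg x^a] times a neighbour of [i]
    ([packs_star_leq]), which is the degree condition.  Conversely, adding edges
    preserves packings, so that it suffices to exhibit four edges in the
    spanning subgraph of each type, a finite check over the vertices of the type
    and the possible sets of neighbours of an outside vertex ([listed_shapes_ok],
    [shapeS7_ok], [shapeS12_ok]). *)

(** * Packings of edges *)

Section Packings.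
Variables (T : eqType) (e : rel T).
Hypotheses (e_sym : ssrbool.symmetric e) (e_irr : irreflexive e).
Implicit Types (c : T -> nat) (s : seq (T * T)).

(** The ends of the edges of [s], with multiplicity. *)
Fixpoint ends s : seq T := if s is x :: s' then [:: x.1, x.2 & ends s'] else [::].

Definition edges s : bool := all (fun x => e x.1 x.2) s.

(** Some [k] edges, repetitions allowed, use each vertex [v] at most [c v] times. *)
Definition packs c k : Prop := exists s,
  [/\ size s = k, edges s & forall v, count_mem v (ends s) <= c v].

(** The capacities [c], raised at [v] by 4; this is as good as an infinite capacity
    when four edges are to be packed. *)
Definition star c v : T -> nat := fun w => c w + 4 * (w == v).

Lemma size_ends s : size (ends s) = (size s).*2.
Proof. by elim: s => // x s IH; rewrite /= IH doubleS. Qed.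

Lemma ends_cat s s' : ends (s ++ s') = ends s ++ ends s'.
Proof. by elim: s => //= x s ->. Qed.

Lemma packs_le c c' k : (forall v, c v <= c' v) -> packs c k -> packs c' k.
Proof. by move=> le [s [? ? H]]; exists s; split=> // v; apply: leq_trans (H v) _. Qed.

Lemma edge_neq x y : e x y -> x != y.
Proof. by apply: contraTneq => ->; rewrite e_irr. Qed.

Lemma count_ends_le s v : edges s -> count_mem v (ends s) <= size s.
Proof.
elim: s => // -[x y] s IH /= /andP[/edge_neq xy /IH].
have : ~~ ((x == v) && (y == v)) by apply: contra xy => /andP[/eqP-> /eqP->].
by case: (x == v); case: (y == v) => //= _; clear; lia.
Qed.

Lemma pick_edge s w : edges s -> w \in ends s -> exists z s1,
  [/\ e w z, edges s1, size s = (size s1).+1 &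
      forall v, count_mem v (ends s) = (w == v) + (z == v) + count_mem v (ends s1)].
Proof.
elim: s => // -[x y] s IH /= /andP[exy es]; rewrite !inE /= => /or3P[/eqP->|/eqP->|ws].
- by exists y, s; split=> // v; rewrite /= addnA.
- by exists x, s; split=> [|//|//|v]; rewrite 1?e_sym //= addnA (addnC (y == v)).
have [z [s1 [ewz es1 -> cs]]] := IH es ws.
exists z, ((x, y) :: s1); split=> //=; first by rewrite exy.
by move=> v; rewrite /= cs; clear; lia.
Qed.

Ltac split_at v w z wz :=
  have [?|_] := eqVneq w v; have [?|_] := eqVneq z v;
  try subst v; try (by move: wz; subst; rewrite eqxx).

(** Let [M] be a maximum packing and [u] a vertex of which [M] leaves a copy unused.
    Every packing [N] for the capacities raised at [u] may be traded for one of the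
    same size that uses the vertices other than [u] at most as often as [M] does.  If
    [N] uses some [w] other than [u] more often than [M] does, remove an edge [w z]
    from [N] and an edge [z z'] from [M]: with the capacities of [w] and [z] lowered by
    one, the rest of [M] is still a maximum packing and [z'] has an unused copy, so
    the induction applies, and [z z'] can be added to the packing that it gives. *)
Lemma exchange k : forall c M N u K,
    size M = k -> edges M -> (forall v, count_mem v (ends M) <= c v) ->
    ~ packs c k.+1 -> count_mem u (ends M) < c u ->
    edges N -> (forall v, count_mem v (ends N) <= c v + K * (v == u)) ->
  exists N' K', [/\ size N' = size N, edges N' &
    forall v, count_mem v (ends N') <= count_mem v (ends M) + K' * (v == u)].
Proof.
elim: k => [|k IH] c M N u K sM eM fM maxM cu eN fN;
  (have [/allP Nok | /allPn[w wN]] :=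
    boolP (all (fun v => (v == u) || (count_mem v (ends N) <= count_mem v (ends M)))
               (ends N)); first
    by exists N, (count_mem u (ends N)); split=> // v;
       have [/Nok|/count_memPn->//] := boolP (v \in ends N);
       have [->|_ /= le] := eqVneq v u; rewrite ?eqxx ?muln1 ?leq_addl // (leq_trans le) ?leq_addr);
  rewrite negb_or -ltnNge => /andP[wu ltw];
  have [z [N1 [ewz eN1 sN cN]]] := pick_edge eN wN;
  have wz := edge_neq ewz;
  (* Otherwise the edge [w z] could be added to [M]. *)
  (have cz : c z <= count_mem z (ends M)
    by rewrite leqNgt; apply/negP => ltz; case: maxM; exists ((w, z) :: M); split;
       [rewrite /= sM | rewrite /= ewz | move=> v; rewrite /=; move: (fM v) (fN w);
        split_at v w z wz;
        rewrite ?(negbTE wu) ?(negbTE wz) ?eqxx; move: ltz ltw; clear; lia]);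
  have zu : z != u by apply: contraTneq cu => <-; rewrite -leqNgt.
- have := fN z; rewrite cN (negbTE zu); move: cz.
  by rewrite (size0nil sM) /= eqxx; clear; lia.
have zM : z \in ends M.
  rewrite -has_pred1 has_count; move: (fN z) (fM z); rewrite cN eqxx (negbTE zu).
  by move: cz; clear; lia.
have [z' [M1 [ezz' eM1 sM1 cM]]] := pick_edge eM zM.
have wz' : (z == w) = false by rewrite eq_sym (negbTE wz).
pose c' v := c v - (z == v) - (w == v).
have cwN : 0 < c w by move: (fN w) ltw; rewrite (negbTE wu); clear; lia.
have czN : 0 < c z by move: (fM z); rewrite cM eqxx; clear; lia.
have fM1 v : count_mem v (ends M1) <= c' v.
  rewrite /c'; move: (fM v) (fN w) ltw; rewrite !cM (negbTE wu).
  split_at v w z wz; rewrite ?eqxx ?(negbTE wz) ?wz' ?(negbTE wu); clear; lia.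
have maxM1 : ~ packs c' k.+1.
  move=> [s [ss es fs]]; case: maxM; exists ((w, z) :: s); split.
  - by rewrite /= ss.
  - by rewrite /= ewz.
  move=> v; move: (fs v); rewrite /c' /=.
  by split_at v w z wz; rewrite ?eqxx ?(negbTE wz) ?wz'; move: cwN czN; clear; lia.
have cu1 : count_mem u (ends M1) < c' u.
  by rewrite /c'; move: cu; rewrite cM (negbTE wu) (negbTE zu); clear; lia.
have fN1 v : count_mem v (ends N1) <= c' v + K * (v == u).
  move: (fN v); rewrite /c' cN.
  by split_at v w z wz; rewrite ?eqxx ?(negbTE wz) ?wz' ?(negbTE wu) ?(negbTE zu); clear; lia.
have sM1' : size M1 = k by move: sM; rewrite sM1 => -[].
have [N' [K' [sN' eN' fN']]] := IH c' M1 N1 u K sM1' eM1 fM1 maxM1 cu1 eN1 fN1.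
exists ((z, z') :: N'), K'; split; first by rewrite /= sN' sN.
  by rewrite /= ezz'.
by move=> v; rewrite /= cM; move: (fN' v); clear; lia.
Qed.

End Packings.

(** * Counting, and copies of vertices *)

Section FinitePackings.
Variables (T : finType) (e : rel T).
Hypotheses (e_sym : ssrbool.symmetric e) (e_irr : irreflexive e).
Implicit Types (c : T -> nat) (s : seq (T * T)).

Lemma packs_dec c k : packs e c k \/ ~ packs e c k.
Proof.
have [/existsP[t /andP[et /forallP ct]]|/existsPn Nex] := boolP
  [exists t : k.-tuple (T * T),
     edges e t && [forall v, count_mem v (ends t) <= c v]].
  by left; exists t; rewrite size_tuple.
right=> -[s [/eqP ss es cs]]; have /negP[] := Nex (Tuple ss).
by rewrite es; apply/forallP.
Qed.

Lemma sum_count_mem (r : seq T) : \sum_v count_mem v r = size r.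
Proof.
elim: r => [|x r IH] /=; first by rewrite big1.
rewrite big_split /= IH (bigD1 x) //= eqxx big1 ?addn0 // => v.
by rewrite eq_sym => /negbTE->.
Qed.

Lemma count_ends_nbrs s u : edges e s ->
  count_mem u (ends s) <= \sum_(v | e u v) count_mem v (ends s).
Proof.
elim: s => [|[x y] s IH] //= /andP[exy /IH les].
have one w : \sum_(v | e u v) (w == v) = e u w.
  have [euw|neuw] := boolP (e u w).
    by rewrite (bigD1 w) //= eqxx big1 // => v /andP[_]; rewrite eq_sym => /negbTE->.
  by apply: big1 => v; apply: contraTeq; rewrite eqb0 negbK => /eqP<-.
rewrite big_split big_split /= !one !addnA leq_add //.
have [xu|_] := eqVneq x u; have [yu|_] := eqVneq y u => //; move: exy.
- by rewrite xu yu e_irr.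
- by rewrite xu => ->; rewrite addn1.
- by rewrite e_sym yu => ->.
Qed.

(** A packing that uses [u] exactly [t] times uses neighbours of [u] at least [t]
    times, and vertices other than [u] exactly [2 * k - t] times. *)
Lemma packs_star_leq c u k : packs e (star c u) k ->
  k.*2 <= \sum_(v | v != u) c v + \sum_(v | e u v) c v.
Proof.
move=> [s [<- es cs]].
have out v : v != u -> count_mem v (ends s) <= c v.
  by move=> vu; have := cs v; rewrite /star (negbTE vu) addn0.
rewrite -size_ends -sum_count_mem (bigD1 u) //= addnC leq_add //.
  exact: leq_sum.
apply: leq_trans (count_ends_nbrs u es) _; apply: leq_sum => v euv; apply: out.
by apply: contraTneq euv => ->; rewrite e_irr.
Qed.

End FinitePackings.

Section Copies.
Variables (T : eqType) (e : rel T) (x0 : T).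
Implicit Types (vs : seq T).

(** The graph on positions that a list of copies of vertices inherits. *)
Definition copy_rel vs : rel nat := fun p q => e (nth x0 vs p) (nth x0 vs q).

(** Inside [r], four edges use each position other than [p] at most once. *)
Definition star_at (E : rel nat) (r : seq nat) (p : nat) : Prop := exists s,
  [/\ size s = 4, edges E s, {subset ends s <= r} &
      forall q, q != p -> count_mem q (ends s) <= 1].

(** A packing bounded by the multiplicities of a list can be realised by disjoint
    edges between positions of the list. *)
Lemma lift_copies vs s : (forall v, count_mem v (ends s) <= count_mem v vs) ->
  exists s', [/\ s = [seq (nth x0 vs x.1, nth x0 vs x.2) | x <- s'],
    uniq (ends s') & forall p, p \in ends s' -> p < size vs].
Proof.
case/count_subseqP => r /perm_to_subseq[r' perm_vs] perm_r.
have : perm_eq (ends s ++ r') vs by rewrite perm_sym (permPl perm_vs) perm_cat2r perm_sym.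
case/(perm_iotaP x0) => l perm_l def_l.
pose l1 := take (size (ends s)) l.
have def_l1 : ends s = [seq nth x0 vs p | p <- l1].
  by rewrite map_take -def_l take_size_cat.
have uniq_l : uniq l1.
  by have := iota_uniq 0 (size vs); rewrite -(perm_uniq perm_l); apply/subseq_uniq/take_subseq.
have lt_l p : p \in l1 -> p < size vs.
  by move/mem_take; rewrite (perm_mem perm_l) mem_iota.
suff [s' [-> def_s']] : exists s',
    s = [seq (nth x0 vs x.1, nth x0 vs x.2) | x <- s'] /\ ends s' = l1.
  by exists s'; rewrite def_s'.
elim: (s) (l1) def_l1 => [|[x y] s1 IH] [|p [|q l2]] //=; first by exists [::].
by case=> -> -> /IH[s' [-> <-]]; exists ((p, q) :: s').
Qed.

Lemma ends_map (T1 T2 : eqType) (f : T1 -> T2) s :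
  ends [seq (f x.1, f x.2) | x <- s] = map f (ends s).
Proof. by elim: s => //= x s ->. Qed.

Lemma copies_packs vs (s : seq (nat * nat)) : edges (copy_rel vs) s -> uniq (ends s) ->
  (forall p, p \in ends s -> p < size vs) -> packs e (fun v => count_mem v vs) (size s).
Proof.
move=> es us lts; exists [seq (nth x0 vs x.1, nth x0 vs x.2) | x <- s]; split.
- by rewrite size_map.
- by rewrite /edges all_map.
move=> v; rewrite ends_map -[vs in leqRHS](mkseq_nth x0) !count_map -!size_filter.
apply: uniq_leq_size; first exact: filter_uniq.
by move=> p; rewrite !mem_filter mem_iota => /andP[-> /lts].
Qed.

Lemma star_copies vs (r : seq nat) p : uniq r ->
    packs e (star (fun v => count_mem v [seq nth x0 vs q | q <- r]) (nth x0 vs p)) 4 ->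
  star_at (copy_rel vs) (p :: r) p.
Proof.
move=> ur [s [ss es cs]].
(* The four additional copies of the vertex at [p] are sent back to [p] by [f]. *)
pose f := nth p r; pose vs' := [seq nth x0 vs q | q <- r ++ nseq 4 p].
have [s'] : exists s', [/\ s = [seq (nth x0 vs' x.1, nth x0 vs' x.2) | x <- s'],
    uniq (ends s') & forall p, p \in ends s' -> p < size vs'].
  apply: lift_copies => v; apply: leq_trans (cs v) _.
  by rewrite /vs' map_cat map_nseq count_cat count_nseq /= /star mulnC eq_sym.
case=> def_s us lts.
have def_vs' q : q < size vs' -> nth x0 vs' q = nth x0 vs (f q).
  rewrite size_map size_cat size_nseq => ltq.
  rewrite (nth_map p) ?size_cat ?size_nseq // nth_cat /f.
  by case: ltnP => // leq; rewrite (nth_default _ leq) nth_nseq if_same.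
exists [seq (f x.1, f x.2) | x <- s']; split.
- by rewrite -ss def_s !size_map.
- move: es; rewrite def_s /edges !all_map => /allP es'; apply/allP=> -[q1 q2] qs'.
  have qe : (q1 \in ends s') && (q2 \in ends s').
    elim: (s') qs' => //= x s1 IH; rewrite !inE => /orP[/eqP<-|/IH/andP[-> ->]].
      by rewrite !eqxx orbT.
    by rewrite !orbT.
  by case/andP: qe => /lts lt1 /lts lt2; have := es' _ qs'; rewrite /= /copy_rel !def_vs'.
- move=> q; rewrite ends_map => /mapP[q' _ ->]; rewrite inE /f.
  have [ltq|leq] := ltnP q' (size r); first by rewrite mem_nth ?orbT.
  by rewrite nth_default ?eqxx.
move=> q qp; rewrite ends_map count_map.
apply: leq_trans (_ : count_mem (index q r) (ends s') <= 1).
  apply: sub_count => q' /= /eqP fq'.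
  have [ltq|leq] := ltnP q' (size r); first by rewrite -fq' index_uniq.
  by move: fq' qp; rewrite /f nth_default // => ->; rewrite eqxx.
by rewrite count_uniq_mem // leq_b1.
Qed.

End Copies.

(** * Disjoint edges in small graphs *)

Section Matchings.
Implicit Types (E L : seq (nat * nat)) (r l : seq nat).

Definition disjoint_from (x y : nat * nat) : bool :=
  [&& y.1 != x.1, y.1 != x.2, y.2 != x.1 & y.2 != x.2].

(** Some [k] pairs of [E] are pairwise disjoint. *)
Fixpoint has_matching (k : nat) (E : seq (nat * nat)) : bool :=
  if k is k'.+1 then
    (fix try (E : seq (nat * nat)) : bool :=
      if E is x :: E' then
        has_matching k' [seq y <- E' | disjoint_from x y] || try E'
      else false) E
  else true.

Definition flip (x : nat * nat) := (x.2, x.1).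

(** Membership of an unordered pair in [L]; this form evaluates faster than the
    equivalent one of [joinedE]. *)
Definition joined L p q : bool := 
  has (fun x => if eqn x.1 p then eqn x.2 q || eqn x.1 q && eqn x.2 p
                else eqn x.1 q && eqn x.2 p) L.

Lemma joinedE L p q : joined L p q = ((p, q) \in L) || ((q, p) \in L).
Proof.
elim: L => //= -[x y] L ->; rewrite !inE /= !xpair_eqE !eqnE.
rewrite (eq_sym p) (eq_sym q x) (eq_sym q y) (eq_sym p y).
by case: (x == p); case: (y == q); case: (x == q); case: (y == p); rewrite /= ?orbT ?orbF.
Qed.

(** All pairs of elements of [r], each in the order of [r]. *)
Fixpoint pairs r : seq (nat * nat) :=
  if r is p :: r' then [seq (p, q) | q <- r'] ++ pairs r' else [::].

Lemma mem_pairs r p q : p \in r -> q \in r -> p != q -> joined (pairs r) p q.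
Proof.
rewrite joinedE; elim: r => //= x r IH; rewrite !inE !mem_cat.
case/predU1P=> [->|pr] /predU1P[->|qr] pq; first by rewrite eqxx in pq.
- by rewrite map_f.
- by rewrite (map_f (pair x) pr) orbT.
by case/orP: (IH pr qr pq) => ->; rewrite ?orbT.
Qed.

Lemma pairs_neq r x : uniq r -> x \in pairs r -> [/\ x.1 \in r, x.2 \in r & x.1 != x.2].
Proof.
elim: r => //= p r IH /andP[pr ur]; rewrite mem_cat => /orP[/mapP[q qr ->]|/(IH ur)[? ? ?]] /=.
  by rewrite !inE eqxx qr orbT; split=> //; apply: contraNneq pr => ->.
by split=> //; rewrite inE; apply/orP; right.
Qed.

Lemma perm_ends (T : eqType) (s t : seq (T * T)) : perm_eq s t -> perm_eq (ends s) (ends t).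
Proof.
move=> st; apply/permP => a.
have cnt u : count a (ends u) = \sum_(x <- u) (a x.1 + a x.2).
  by elim: u => [|x u IH]; rewrite ?big_nil // big_cons /= IH addnA.
by rewrite !cnt (perm_big _ st).
Qed.

Lemma mem_ends (T : eqType) (s : seq (T * T)) x :
  x \in s -> (x.1 \in ends s) && (x.2 \in ends s).
Proof.
elim: s => //= y s IH; rewrite !inE => /predU1P[->|/IH/andP[-> ->]].
  by rewrite !eqxx orbT.
by rewrite !orbT.
Qed.

Lemma mem_endsP (T : eqType) (s : seq (T * T)) q :
  q \in ends s -> exists2 x, x \in s & (q == x.1) || (q == x.2).
Proof.
elim: s => //= y s IH; rewrite !inE orbA => /orP[qy|/IH[x xs qx]].
  by exists y; rewrite ?inE ?eqxx.
by exists x; rewrite ?inE ?xs ?orbT.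
Qed.

Lemma has_matching_sound k E : has_matching k E -> all (fun x => x.1 != x.2) E ->
  exists s, [/\ size s = k, {subset s <= E} & uniq (ends s)].
Proof.
elim: k E => [|k IH] E; first by exists [::].
elim: E => // x E IHE /= /orP[mE|/IHE{}IHE] /andP[x12 nE]; last first.
  have [s [ss sE us]] := IHE nE; exists s; split=> // y /sE.
  by rewrite inE orbC => ->.
have [|s [ss sE us]] := IH _ mE.
  rewrite all_filter; by apply: sub_all nE => y /= ->; rewrite implybT.
have dis y : y \in s -> disjoint_from x y by move/sE; rewrite mem_filter => /andP[].
have notin z : z \in ends s -> (z != x.1) && (z != x.2).
  have: {in s, forall y, disjoint_from x y} by [].
  elim: (s) => //= y t IHt dt; rewrite !inE.
  have /and4P[? ? ? ?] : disjoint_from x y by apply: dt; rewrite inE eqxx.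
  case/or3P=> [/eqP->|/eqP->|]; try by apply/andP.
  by apply: IHt => u ut; apply: dt; rewrite inE ut orbT.
exists (x :: s); split=> /=; first by rewrite ss.
  move=> y; rewrite !inE => /predU1P[->|/sE]; rewrite ?eqxx // mem_filter => /andP[_ ->].
  by rewrite orbT.
rewrite inE us (negbTE x12) andbT /=.
by apply/andP; split; apply: contraTN isT => /notin/andP[]; rewrite eqxx.
Qed.

Lemma has_matching_complete k E s : {subset s <= E} -> uniq (ends s) ->
  k <= size s -> has_matching k E.
Proof.
elim: k E s => // k IH; elim=> [|x E IHE] s sE us ks.
  by case: s sE ks {us} => // y s /(_ y); rewrite inE eqxx => /(_ isT).
have [xs|xs] := boolP (x \in s); apply/orP; [left|right; apply: (IHE s) => //]; last first.
  move=> y ys; have := sE y ys; rewrite inE => /predU1P[yx|//].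
  by rewrite -yx ys in xs.
have ps := perm_to_rem xs.
move: us; rewrite (perm_uniq (perm_ends ps)) /= inE negb_or -!andbA => /and4P[_ x1 x2 us].
apply: (IH _ (rem x s)) => //; last by move: ks; rewrite size_rem //; lia.
move=> y yr; have /andP[y1 y2] := mem_ends yr.
rewrite mem_filter /disjoint_from (memPn x1) // (memPn x2) // (memPn x1) // (memPn x2) //=.
have := sE y (mem_rem yr); rewrite inE => /predU1P[yx|//].
by rewrite yx (negbTE x1) in y1.
Qed.

Lemma has_matching_oriented k E s : {in s, forall x, joined E x.1 x.2} ->
  uniq (ends s) -> k <= size s -> has_matching k E.
Proof.
move=> sE us ks; pose f x := if x \in E then x else flip x.
apply: (@has_matching_complete _ _ (map f s)); rewrite ?size_map //.
  move=> _ /mapP[x xs ->]; rewrite /f; case: ifP => // xE.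
  by have := sE x xs; rewrite joinedE -surjective_pairing xE.
suff /perm_uniq-> : perm_eq (ends (map f s)) (ends s) by [].
elim: (s) => //= x t IH; rewrite /f; case: ifP => _; first by rewrite !perm_cons.
by rewrite -/([:: x.2] ++ [:: x.1] ++ ends (map f t)) perm_catCA /= !perm_cons.
Qed.



(** Even if all pairs of [r] outside [L] were edges, no four edges inside [r] would
    be disjoint away from [p]: at most [size N] edges meet the possible neighbours [N]
    of [p], every edge at [p] is among them, and the remaining positions [R] do not have
    enough disjoint edges. *)
Definition stuck L r p : bool :=
  let N := [seq q <- r | (q != p) && ~~ joined L p q] in
  let R := [seq q <- r | (q != p) && joined L p q] in
  (size N < 4) && ~~ has_matching (4 - size N) [seq x <- pairs R | ~~ joined L x.1 x.2].

Section Stuck.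
Variable g : rel nat.
Hypotheses (g_sym : ssrbool.symmetric g) (g_irr : irreflexive g).

Definition nonedges L : bool := all (fun x => ~~ g x.1 x.2) L.

Lemma nonedges_joined L p q : nonedges L -> joined L p q -> ~~ g p q.
Proof. by rewrite joinedE => /allP nL /orP[/nL//|/nL]; rewrite g_sym. Qed.

Lemma stuck_no_star L r p : nonedges L -> stuck L r p -> ~ star_at g (p :: r) p.
Proof.
move=> nL; rewrite /stuck; set N := filter _ r; set R := filter _ r.
case/andP=> ltN /negP noM [s [ss es sr cs]].
pose t (x : nat * nat) := (x.1 \in N) || (x.2 \in N).
have cNp q : q \in N -> q != p by rewrite mem_filter => /andP[/andP[]].
have le1 : size (filter t s) <= size N.
  apply: (@leq_trans (size (filter (mem N) (ends s)))).
    elim: (s) => //= x u IH; rewrite /t; case: (x.1 \in N); case: (x.2 \in N) => //=.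
    by rewrite ltnS leqW.
  apply: uniq_leq_size; last by move=> q; rewrite mem_filter => /andP[].
  apply: count_mem_uniq => q; rewrite count_filter mem_filter /=.
  have [qN|qN] := boolP (q \in N); last first.
    apply/eqP; rewrite -leqn0 leqNgt -has_count; apply/hasPn => z _ /=.
    by apply: contraNN qN => /andP[/eqP->].
  rewrite (@eq_count _ _ (pred1 q)) => [|z /=]; last first.
    by have [->|//] := eqVneq z q; rewrite qN.
  have := cs q (cNp q qN); have [qs|/count_memPn->//] := boolP (q \in ends s).
  by move: qs; rewrite -has_pred1 has_count; case: (count_mem q _) => [|[]].
(* An edge that misses [N] misses [p] too, and lies in [R]. *)
have inner x : x \in s -> ~~ t x -> [/\ x.1 \in R, x.2 \in R & x.1 != x.2].
  move=> xs /norP[x1N x2N]; have gx : g x.1 x.2 by have := allP es x xs.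
  have /andP[/sr x1 /sr x2] := mem_ends xs.
  have inR q : q \in p :: r -> q \notin N -> q != p -> q \in R /\ joined L p q.
    rewrite inE !mem_filter => qr qN qp; move: qr qN; rewrite (negbTE qp) /= => ->.
    by rewrite andbT negbK => ->.
  have x12 : x.1 != x.2 by apply: contraTneq gx => ->; rewrite g_irr.
  have x1p : x.1 != p.
    apply: contraTneq gx => x1p; have [|_] := inR _ x2 x2N; first by rewrite eq_sym -x1p.
    by rewrite x1p => /(nonedges_joined nL).
  have x2p : x.2 != p.
    apply: contraTneq gx => x2p; have [|_] := inR _ x1 x1N; first by rewrite -x2p.
    by rewrite x2p g_sym => /(nonedges_joined nL).
  by have [? _] := inR _ x1 x1N x1p; have [? _] := inR _ x2 x2N x2p.
apply: noM; apply: (@has_matching_oriented _ _ (filter (predC t) s)).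
- move=> x; rewrite mem_filter => /andP[tx xs].
  have [x1R x2R x12] := inner x xs tx; have := mem_pairs x1R x2R x12.
  have gx : g x.1 x.2 by have := allP es x xs.
  have : ~~ joined L x.1 x.2 by apply: contraL gx => /(nonedges_joined nL).
  rewrite !(joinedE [seq _ <- _ | _]) (joinedE (pairs _)) !mem_filter /= => nLx.
  have nLx' : ~~ joined L x.2 x.1 by rewrite joinedE orbC -joinedE.
  by rewrite nLx nLx'.
- have cs2 q : count_mem q (ends [seq x <- s | predC t x]) <= count_mem q (ends s).
    elim: (s) => //= x u IH; case: ifP => _ /=; first by rewrite !leq_add2l.
    by apply: leq_trans IH _; rewrite addnA leq_addl.
  have np : p \notin ends [seq x <- s | predC t x].
    apply/negP => /mem_endsP[x]; rewrite mem_filter => /andP[tx xs] /orP[]/eqP px;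
    by have [] := inner x xs tx; rewrite -px !mem_filter eqxx.
  apply: count_mem_uniq => q; have [->|qp] := eqVneq q p.
    by rewrite (count_memPn np) (negbTE np).
  have := leq_trans (cs2 q) (cs q qp).
  have [qs|/count_memPn->//] := boolP (q \in ends _).
  by move: qs; rewrite -has_pred1 has_count; case: (count_mem q _) => [|[]].
have -> : size [seq x <- s | predC t x] = 4 - size (filter t s).
  by rewrite -ss !size_filter -(count_predC t s) addKn.
by rewrite leq_sub2l.
Qed.

End Stuck.

End Matchings.

Arguments has_matching : simpl never.

(** * Shapes and their realisations *)

(** A shape prescribes weights for the positions of a list of vertices, some edges
    and some nonedges; all other pairs of positions are free. *)
Record shape := Shape {
  wts : seq nat; yes : seq (nat * nat); no : seq (nat * nat) }.

(** Default value for the access to lists of shapes. *)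
Definition no_shape := Shape [::] [::] [::].

Section Embeddings.
Implicit Types (A B : shape) (l : seq nat).

Definition well_formed A : bool :=
  all (fun x => (x.1 < size (wts A)) && (x.2 < size (wts A))) (yes A ++ no A).

(** [l] lists the positions of [A] in an order in which they satisfy [B]. *)
Definition fits_in A B (l : seq nat) : bool :=
  [&& well_formed B, perm_eq l (iota 0 (size (wts A))), [seq nth 0 (wts A) p | p <- l] == wts B,
      all (fun x => joined (yes A) (nth 0 l x.1) (nth 0 l x.2)) (yes B) &
      all (fun x => joined (no A) (nth 0 l x.1) (nth 0 l x.2)) (no B)].

(** Pruning test for [embed_from]: position [p] of [A] may be matched with
    position [size l] of [B]. *)
Definition extends (L L' : seq (nat * nat)) l p : bool :=
  let k := size l in
  all (fun x => if (x.1 == k) && (x.2 < k) then joined L (nth 0 l x.2) p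
                else if (x.2 == k) && (x.1 < k) then joined L (nth 0 l x.1) p
                else true) L'.

(** Backtracking search for a list that passes [fits_in]; [l] is the part chosen so
    far and [free] the positions left.  The conditionals stop a call-by-value
    evaluation from exploring branches that are not needed. *)
Fixpoint embed_from A B n l (free : seq nat) : bool :=
  if n is n'.+1 then
    has (fun p =>
      if [&& nth 0 (wts A) p == nth 0 (wts B) (size l),
             extends (yes A) (yes B) l p & extends (no A) (no B) l p]
      then embed_from A B n' (rcons l p) (rem p free) else false) free
  else fits_in A B l.

(** Up to reordering its positions, [A] contains [B]. *)
Definition embeds A B : bool :=
  if size (wts A) == size (wts B)
  then embed_from A B (size (wts A)) [::] (iota 0 (size (wts A))) else false.

Lemma embedsP A B : embeds A B -> exists l, fits_in A B l.
Proof.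
rewrite /embeds; case: ifP => // _; set n := size _; move: [::] (iota 0 n).
elim: n => /= [l f|n IH l f]; first by exists l.
by case/hasP=> p _; case: ifP => // _ /IH.
Qed.

(** Positions [p] and [q] are identified to the new position 0, and their weights
    added; [f] renames the old positions. *)
Definition merge p q A : shape :=
  let l := [seq r <- iota 0 (size (wts A)) | (r != p) && (r != q)] in
  let f x := (index x [:: p, q & l]).-1 in
  Shape (nth 0 (wts A) p + nth 0 (wts A) q :: [seq nth 0 (wts A) r | r <- l])
        [seq (f x.1, f x.2) | x <- yes A] [seq (f x.1, f x.2) | x <- no A].

(** Some position is adjacent to one of [p] and [q] and not to the other, so that [p]
    and [q] cannot hold the same vertex. *)
Definition distinguished A p q : bool :=
  has (fun r => joined (yes A) p r && joined (no A) q r ||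
                joined (no A) p r && joined (yes A) q r) (iota 0 (size (wts A))).

(** Whenever two positions of [A] may hold the same vertex, identifying them leads to
    one of the shapes [Bs]. *)
Definition merges_into (Bs : seq shape) A : bool :=
  well_formed A &&
  all (fun x => [|| joined (yes A) x.1 x.2, distinguished A x.1 x.2 |
                    has (embeds (merge x.1 x.2 A)) Bs]) (pairs (iota 0 (size (wts A)))).

End Embeddings.

Section Realisations.
Variables (T : eqType) (e : rel T) (x0 : T).
Hypotheses (e_sym : ssrbool.symmetric e) (e_irr : irreflexive e).
Implicit Types (vs : seq T) (c : T -> nat).

Local Notation nth := (nth x0).

(** The total weight of the positions of [vs] which hold [v]. *)
Definition weight_at vs ws v : nat :=
  \sum_(p <- iota 0 (size ws) | nth vs p == v) seq.nth 0 ws p.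

(** [vs] satisfies [A] and distributes the capacities [c]; a vertex may occur in [vs]
    more than once, its weights then add up. *)
Definition realises c vs A : Prop :=
  [/\ size vs = size (wts A), forall v, weight_at vs (wts A) v = c v,
      edges (copy_rel e x0 vs) (yes A) & nonedges (copy_rel e x0 vs) (no A)].

Lemma copy_sym vs : ssrbool.symmetric (copy_rel e x0 vs).
Proof. by move=> p q; apply: e_sym. Qed.

Lemma copy_irr vs : irreflexive (copy_rel e x0 vs).
Proof. by move=> p; apply: e_irr. Qed.

Lemma edges_joined vs L p q :
  edges (copy_rel e x0 vs) L -> joined L p q -> copy_rel e x0 vs p q.
Proof. by rewrite joinedE => /allP eL /orP[/eL//|/eL]; rewrite copy_sym. Qed.

Lemma weight_at_map vs ws l v :
  weight_at [seq nth vs p | p <- l] [seq seq.nth 0 ws p | p <- l] v =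
  \sum_(p <- l | nth vs p == v) seq.nth 0 ws p.
Proof.
rewrite /weight_at size_map -[l in RHS](mkseq_nth 0) big_map big_seq_cond [RHS]big_seq_cond.
apply: eq_big => [p|p /andP[]]; rewrite ?mem_iota add0n /=; last first.
  by move=> ltp _; rewrite (nth_map 0).
by apply: andb_id2l => ltp; rewrite (nth_map 0).
Qed.

Lemma weight_at_ones vs v : weight_at vs (nseq (size vs) 1) v = count_mem v vs.
Proof.
rewrite -[vs in RHS](mkseq_nth x0) /weight_at size_nseq count_map -sum1_count.
rewrite big_seq_cond [RHS]big_seq_cond; apply: eq_bigr => p.
by rewrite mem_iota nth_nseq /= => /andP[->].
Qed.

Lemma weight_at_cons x w vs ws v :
  weight_at (x :: vs) (w :: ws) v = (x == v) * w + weight_at vs ws v.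
Proof.
rewrite /weight_at /= big_cons /= (iotaDl 1) big_map.
by case: (x == v); rewrite ?mul1n.
Qed.

Lemma realises_embeds c vs (A B : shape) : realises c vs A -> embeds A B ->
  exists vs', realises c vs' B.
Proof.
move=> [sv wv ev nv] /embedsP[l /and5P[wfB pl /eqP wB yB nB]].
have szl : size l = size (wts A) by rewrite (perm_size pl) size_iota.
have szB : size (wts B) = size l by rewrite -wB size_map.
exists [seq nth vs p | p <- l]; split.
- by rewrite size_map szB.
- by move=> v; rewrite -wB weight_at_map (perm_big _ pl) -wv.
- apply/allP=> x xB; have /allP/(_ x) := wfB; rewrite mem_cat xB => /(_ isT)/andP[].
  rewrite szB => x1 x2; rewrite /copy_rel !(nth_map 0) //.
  by apply: edges_joined ev _; apply: (allP yB).
- apply/allP=> x xB; have /allP/(_ x) := wfB; rewrite mem_cat xB orbT => /(_ isT)/andP[].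
  rewrite szB => x1 x2; rewrite /copy_rel !(nth_map 0) //.
  by apply: (nonedges_joined (copy_sym vs) nv); apply: (allP nB).
Qed.

Lemma realises_merge c vs A p q : well_formed A -> realises c vs A ->
    p < size vs -> q < size vs -> p != q -> nth vs p = nth vs q ->
  exists2 vs', realises c vs' (merge p q A) & size vs' < size vs.
Proof.
move=> wfA [sv wv ev nv] ltp ltq pq vpq; rewrite /merge.
set l := filter _ _.
have pl : perm_eq [:: p, q & l] (iota 0 (size (wts A))).
  apply: uniq_perm; rewrite ?iota_uniq //=.
    by rewrite !inE !mem_filter !eqxx (negbTE pq) andbF filter_uniq ?iota_uniq.
  move=> r; rewrite !inE mem_filter mem_iota add0n -sv /=.
  have [->|_] := eqVneq r p; first by rewrite ltp.
  by have [->|_] := eqVneq r q; first by rewrite ltq.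
set f := fun x => (index x [:: p, q & l]).-1.
pose vs' := nth vs p :: [seq nth vs r | r <- l].
have nthf r : r < size (wts A) -> nth vs' (f r) = nth vs r.
  move=> ltr; rewrite /f /vs' /=.
  have [<-//|pr] := eqVneq p r; have [<-//|qr] := eqVneq q r => /=.
  have rl : r \in l by rewrite mem_filter mem_iota /= ltr eq_sym pr eq_sym qr.
  by rewrite (nth_map 0) ?index_mem // nth_index.
exists vs'.
  split=> [|v|/=|/=]; first by rewrite /= !size_map.
  - rewrite -wv /= weight_at_cons weight_at_map /weight_at -(perm_big _ pl) !big_cons /=.
    by rewrite -vpq; case: (_ == v); rewrite ?mul1n ?addnA.
  - rewrite /edges all_map; apply/allP=> x xA; rewrite /copy_rel /=.
    have /allP/(_ x) := wfA; rewrite mem_cat xA => /(_ isT)/andP[x1 x2].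
    by rewrite !nthf //; apply: (allP ev).
  rewrite /nonedges all_map; apply/allP=> x xA; rewrite /copy_rel /=.
  have /allP/(_ x) := wfA; rewrite mem_cat xA orbT => /(_ isT)/andP[x1 x2].
  by rewrite !nthf //; apply: (allP nv).
by have := perm_size pl; rewrite size_iota -sv /= size_map => <-.
Qed.

(** One of the shapes is realised by distinct vertices. *)
Definition realises_some c (Bs : seq shape) : Prop := exists k vs,
  [/\ k < size Bs, uniq vs & realises c vs (seq.nth no_shape Bs k)].

Lemma realises_uniq_or_merge Bs c vs A : merges_into Bs A -> realises c vs A ->
  uniq vs \/ exists k vs', [/\ k < size Bs, realises c vs' (seq.nth no_shape Bs k) &
                              size vs' < size vs].
Proof.
case/andP=> wfA /allP mA rA; have [|/(uniqPn x0)[p [q [pq ltq vpq]]]] := boolP (uniq vs).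
  by left.
right; have [sv wv ev nv] := rA; have ltp := ltn_trans pq ltq.
have : joined (pairs (iota 0 (size (wts A)))) p q.
  by rewrite mem_pairs ?mem_iota -?sv ?(ltn_eqF pq).
have nepq : p != q by rewrite (ltn_eqF pq).
suff main i j : i < size vs -> j < size vs -> i != j -> nth vs i = nth vs j ->
    (i, j) \in pairs (iota 0 (size (wts A))) -> exists k vs',
    [/\ k < size Bs, realises c vs' (seq.nth no_shape Bs k) & size vs' < size vs].
  by rewrite joinedE => /orP[]; apply: main => //; rewrite eq_sym.
move=> lti ltj ij vij /mA /= /or3P[jo|/hasP[r _ /orP[]/andP[j1 j2]]|].
- by have := edges_joined ev jo; rewrite /copy_rel vij e_irr.
- have := edges_joined ev j1; have := nonedges_joined (copy_sym vs) nv j2.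
  by rewrite /copy_rel vij => /negbTE->.
- have := edges_joined ev j2; have := nonedges_joined (copy_sym vs) nv j1.
  by rewrite /copy_rel vij => /negbTE->.
case/(has_nthP no_shape) => k ltk emb.
have [vs1 r1 lt1] := realises_merge wfA rA lti ltj ij vij.
have [vs2 r2] := realises_embeds r1 emb; exists k, vs2; split=> //.
have [-> _ _ _] := r2; move: emb; rewrite /embeds; case: eqP => // <- _; by have [<- _ _ _] := r1.
Qed.

(** Identifying repeated vertices, as long as there are any, leads to a realisation
    by distinct vertices. *)
Lemma realises_uniq Bs c vs A : all (merges_into Bs) Bs -> merges_into Bs A ->
  realises c vs A -> uniq vs \/ realises_some c Bs.
Proof.
move=> mBs; have [n] := ubnP (size vs); elim: n => // n IH in vs A *.
rewrite ltnS => ltn mA rA; have [|[k [vs' [ltk rk lt']]]] := realises_uniq_or_merge mA rA.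
  by left.
have mk : merges_into Bs (seq.nth no_shape Bs k) by exact: (all_nthP no_shape mBs).
have [uv|] := IH vs' _ (leq_trans lt' ltn) mk rk; last by right.
by right; exists k, vs'.
Qed.

Lemma realises_someI Bs c A vs : all (merges_into Bs) Bs -> has (embeds A) Bs ->
  realises c vs A -> realises_some c Bs.
Proof.
move=> mBs /(has_nthP no_shape)[k ltk emb] rA.
have [vs' rk] := realises_embeds rA emb.
have mk : merges_into Bs (seq.nth no_shape Bs k) by exact: (all_nthP no_shape mBs).
by have [uv|//] := realises_uniq mBs mk rk; exists k, vs'.
Qed.

End Realisations.

(** * Search along a decision tree *)

(** [Split p q y n] asks whether [p] and [q] are adjacent, and goes on with [y] if
    they are and with [n] if they are not. *)
Inductive plan := Leaf | Split of nat & nat & plan & plan.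

(** The positions are those below [d]; [Y] and [N] collect the edges and nonedges on
    the current branch, and [(p, r)] in [stars] promises four edges inside [r] that
    are disjoint away from [p]. *)
Fixpoint search (stars : seq (nat * seq nat)) (Bs : seq shape) (d : nat)
    (Y N : seq (nat * nat)) (t : plan) : bool :=
  match t with
  | Leaf => if has_matching 4 Y then true
            else if has (fun s => stuck N s.2 s.1) stars then true
            else has (embeds (Shape (nseq d 1) Y N)) Bs
  | Split p q y n => [&& p < d, q < d,
      search stars Bs d ((p, q) :: Y) N y & search stars Bs d Y ((p, q) :: N) n]
  end.

Section SearchSoundness.
Variables (T : eqType) (e : rel T) (x0 : T) (vs : seq T).
Hypotheses (e_sym : ssrbool.symmetric e) (e_irr : irreflexive e).
Local Notation g := (copy_rel e x0 vs).
Local Notation cnt := (fun v => count_mem v vs).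

Lemma realises_ones Y N : edges g Y -> nonedges g N ->
  realises e x0 cnt vs (Shape (nseq (size vs) 1) Y N).
Proof.
move=> gY gN; by split=> //= [|v]; rewrite ?size_nseq ?weight_at_ones.
Qed.

Lemma matching_packs Y : edges g Y ->
    (forall x, x \in Y -> (x.1 < size vs) && (x.2 < size vs)) -> has_matching 4 Y ->
  packs e cnt 4.
Proof.
move=> eY Yd m4; have [|s [s4 sY us]] := has_matching_sound m4.
  by apply/allP=> x xY; apply: contraTneq (allP eY x xY) => ->; rewrite copy_irr.
rewrite -s4; apply: (@copies_packs _ _ x0) => //.
  by apply/allP=> x /sY; apply: (allP eY).
by move=> r /mem_endsP[x /sY/Yd/andP[? ?] /orP[]/eqP->].
Qed.

(** If the copies [vs] do not pack four edges, but do so at each of [stars], then they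
    realise one of the shapes [Bs]. *)
Lemma search_sound stars Bs Y N t :
    ~ packs e cnt 4 ->
    (forall p r, (p, r) \in stars -> star_at g (p :: r) p) ->
    (forall x, x \in Y -> (x.1 < size vs) && (x.2 < size vs)) ->
    edges g Y -> nonedges g N ->
    search stars Bs (size vs) Y N t ->
  exists k vs', k < size Bs /\ realises e x0 cnt vs' (nth no_shape Bs k).
Proof.
have g_sym := copy_sym x0 e_sym vs; have g_irr := copy_irr x0 e_irr vs.
move=> no4 st; elim: t Y N => [|p q y IHy n IHn] Y N Yd gY gN /=.
  case: ifP => [m4 _|_]; last case: ifP => [/hasP[[p r] s pr] _|_ /(has_nthP no_shape)[k ltk emb]].
  - by case: no4; apply: matching_packs m4.
  - by case: (stuck_no_star g_sym g_irr gN pr); apply: st.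
  have [vs' rk] := realises_embeds e_sym (realises_ones gY gN) emb.
  by exists k, vs'.
case/and4P=> ltp ltq Hy Hn; have [gpq|gpq] := boolP (g p q).
  apply: IHy Hy => //; last by rewrite /edges /= gpq.
  by move=> x; rewrite inE => /predU1P[->|/Yd//]; rewrite ltp.
by apply: IHn Hn => //; rewrite /nonedges /= gpq.
Qed.

End SearchSoundness.

(** * The shapes of the types *)

(** The edges of the cycle through [l]. *)
Definition cyc (l : seq nat) : seq (nat * nat) := zip l (rot 1 l).

Definition cross (l l' : seq nat) : seq (nat * nat) := [seq (p, q) | p <- l, q <- l'].

(** All weights are one. *)
Definition simple n Y N : shape := Shape (nseq n 1) Y N.

Definition shapeS1 := simple 5 (pairs [:: 0; 1; 2; 3; 4]) [::].
Definition shapeS2 :=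
  simple 6 (cyc [:: 1; 2; 3; 4; 5] ++ [seq (0, p) | p <- [:: 1; 2; 3; 4; 5]]) [::].
Definition shapeS3 :=
  simple 6 (cyc [:: 0; 2; 3] ++ cyc [:: 1; 2; 3] ++ cyc [:: 0; 4; 5] ++ cyc [:: 1; 4; 5]) [::].
Definition shapeS4 :=
  simple 6 (cyc [:: 0; 1; 2] ++ cyc [:: 3; 4; 5] ++ [:: (0, 3); (1, 4); (2, 5)]) [::].
Definition shapeS5 :=
  simple 8 (cyc [:: 0; 1; 2] ++ cyc [:: 3; 4; 5; 6; 7])
    (cross [:: 0; 1; 2] [:: 3; 4; 5; 6; 7]).
Definition shapeS6 :=
  simple 8 (cyc [:: 0; 1; 2] ++ cyc [:: 3; 4; 5] ++ cyc [:: 3; 6; 7])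
    (cross [:: 0; 1; 2] [:: 3; 4; 5; 6; 7]).
Definition shapeS7 :=
  simple 7 (cyc [:: 0; 1; 2] ++ pairs [:: 3; 4; 5; 6]) (cross [:: 0; 1; 2] [:: 3; 4; 5; 6]).
Definition shapeS8 := simple 7 (cyc [:: 0; 1; 2; 3; 4; 5; 6]) [::].
Definition shapeS9 := simple 7 (cyc [:: 0; 1; 2] ++ cyc [:: 0; 3; 4; 5; 6]) [::].
Definition shapeS10 := simple 7 (cyc [:: 0; 1; 2; 3; 4] ++ cyc [:: 0; 1; 2; 5; 6]) [::].
Definition shapeS11 :=
  simple 7 (cyc [:: 0; 1; 2] ++ cyc [:: 0; 3; 4] ++ cyc [:: 0; 5; 6]) [::].
Definition shapeS12 :=
  simple 7 (cyc [:: 0; 1; 2] ++ cyc [:: 4; 5; 6] ++ [:: (0, 3); (3, 4)]) [::].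
(** The two cases of the second condition of the theorem: the ends of the path are
    adjacent, or there is no edge at all between the triangles.  If there is another
    edge between them, the graph is also of type S8 or S9. *)
Definition shapeS12_joined :=
  simple 7 ((0, 4) :: yes shapeS12) [::].
Definition shapeS12_separated :=
  simple 7 (yes shapeS12) (cross [:: 0; 1; 2] [:: 4; 5; 6]).
Definition shapeS13 :=
  simple 9 (cyc [:: 0; 1; 2] ++ cyc [:: 3; 4; 5] ++ cyc [:: 6; 7; 8])
    (cross [:: 0; 1; 2] [:: 3; 4; 5] ++ cross [:: 0; 1; 2] [:: 6; 7; 8] ++
     cross [:: 3; 4; 5] [:: 6; 7; 8]).

Definition simple_shapes := [:: shapeS1; shapeS2; shapeS3; shapeS4; shapeS5; shapeS6;
  shapeS8; shapeS9; shapeS10; shapeS11; shapeS13].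

Definition shapesW1 := [seq Shape w (cyc [:: 0; 1; 2]) [::] |
  w <- [:: [:: 2; 2; 2]; [:: 3; 2; 2]; [:: 3; 3; 1]]].
Definition shapesW2 := [seq Shape w (cyc [:: 0; 1; 2] ++ [:: (0, 3)]) [::] |
  w <- [:: [:: 3; 1; 1; 2]; [:: 3; 2; 1; 1]; [:: 2; 2; 2; 1]]].
Definition shapesW3 :=
  [:: Shape [:: 1; 1; 2; 2; 1] (cyc [:: 0; 1; 2] ++ [:: (2, 3); (3, 4)]) [::];
      Shape [:: 2; 2; 1; 1; 1] (cyc [:: 0; 1; 2] ++ [:: (0, 3); (1, 4)]) [::];
      Shape [:: 1; 1; 3; 1; 1] (cyc [:: 0; 1; 2] ++ [:: (2, 3); (2, 4)]) [::]].
Definition shapesW4 :=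
  Shape [:: 2; 2; 1; 1] (cyc [:: 0; 1; 2] ++ cyc [:: 0; 1; 3]) [::] ::
  [seq Shape w (cyc [:: 0; 1; 2] ++ cyc [:: 0; 3; 4]) [::] |
    w <- [:: [:: 2; 1; 1; 1; 1]; [:: 2; 2; 1; 1; 1]; [:: 1; 2; 2; 1; 1]]].
Definition shapesW5 :=
  [:: Shape [:: 2; 1; 1; 1; 1; 1] (cyc [:: 0; 1; 2] ++ cyc [:: 0; 3; 4] ++ [:: (0, 5)]) [::];
      Shape [:: 1; 2; 1; 1; 1; 1] (cyc [:: 0; 1; 2] ++ cyc [:: 0; 3; 4] ++ [:: (1, 5)]) [::];
      Shape [:: 2; 1; 1; 1; 1; 1] (cyc [:: 0; 1; 2] ++ cyc [:: 3; 4; 5] ++ [:: (0, 3)]) [::]].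
Definition shapeW6 := Shape [:: 2; 2; 1; 1; 1] (cyc [:: 0; 1; 2; 3; 4]) [::].
Definition shapeW7 :=
  Shape [:: 2; 1; 1; 1; 1; 1] (cyc [:: 0; 1; 2; 3; 4] ++ [:: (0, 5)]) [::].
Definition shapeW8 :=
  Shape [:: 2; 1; 1; 1; 1; 1] (cyc [:: 0; 1; 2; 3] ++ cyc [:: 0; 4; 5]) [::].
Definition shapeW9 :=
  Shape [:: 1; 1; 1; 2; 2; 1] (cyc [:: 0; 1; 2] ++ cyc [:: 3; 4; 5])
    (cross [:: 0; 1; 2] [:: 3; 4; 5]).
Definition shapeW10 :=
  Shape [:: 1; 1; 1; 2; 1; 1; 1] (cyc [:: 0; 1; 2] ++ cyc [:: 3; 4; 5] ++ [:: (3, 6)])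
    (cross [:: 0; 1; 2] [:: 3; 4; 5; 6]).

Definition weighted_shapes := shapesW1 ++ shapesW2 ++ shapesW3 ++ shapesW4 ++
  shapesW5 ++ [:: shapeW6; shapeW7; shapeW8; shapeW9; shapeW10].

Definition listed_shapes := simple_shapes ++ weighted_shapes.

Lemma listed_shapes_closed : all (merges_into listed_shapes) listed_shapes.
Proof. by vm_compute. Qed.

(** In the types S7 and S12 the vertices are distinct, except that a graph of the first
    form of S12 may be turned into one of the listed types. *)
Lemma special_shapes_closed : all (merges_into listed_shapes)
  [:: shapeS7; shapeS12_joined; shapeS12_separated].
Proof. by vm_compute. Qed.

(** The graphs to be searched have the maximum packing [three_edges] on the positions
    0 to 5; the other positions hold residual copies. *)
Definition three_edges := [:: (0, 1); (2, 3); (4, 5)].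

(** The capacity of each position may be raised. *)
Definition all_stars n := [seq (p, iota 0 n) | p <- iota 0 n].

(** The capacity of each residual copy may be raised, with edges inside the maximum
    packing and that copy. *)
Definition local_stars k := [seq (p, iota 0 6) | p <- iota 6 k].

(** First stages of the search: with seven copies, the odd alternating cycle through
    the residual copy 6 is a triangle, a pentagon or a heptagon; with eight copies,
    one of the two residual copies lies on a triangle. *)
Definition shape7a := simple 7 (three_edges ++ [:: (0, 6); (1, 6)]) [::].
Definition shape7b := simple 7 (three_edges ++ [:: (0, 6); (2, 6); (1, 3)]) [::].
Definition shape8a := simple 8 (three_edges ++ [:: (0, 6); (1, 6)]) [::].

Lemma ninth_vertex :
  all (fun q => has_matching 4 (yes shapeS13 ++ [:: (q, 9)])) (iota 0 9).
Proof. by vm_compute. Qed.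

Lemma shapeS13_bounded : all (fun x => (x.1 < 9) && (x.2 < 9)) (yes shapeS13).
Proof. by vm_compute. Qed.

Definition shapes7 := [:: shapeS8; shapeS9; shapeS10; shapeS11; shapeS7;
  shapeS12_joined; shapeS12_separated].

(** Decision trees for [search]: the first two arguments of each inner node are the pair
    of positions on which it splits. *)
Section Plans.
Local Notation L := Leaf.
Local Notation B := Split.

Definition plan5 : plan :=
  B 0 1 (B 0 2 (B 0 3 (B 0 4 (B 1 2 (B 1 3 (B 1 4 (B 2 3 (B 2 4 (B 3 4 L L) L)
  L) L) L) L) L) L) L) L.

Definition plan6 : plan :=
  B 0 2 (B 0 3 (B 0 4 (B 0 5 (B 1 2 (B 1 4 (B 3 5 L (B 1 3 (B 1 5 L (B 2 5 L
  L)) (B 1 5 (B 3 4 L L) L))) (B 3 4 (B 1 5 L (B 1 3 (B 2 5 L (B 3 5 L L)) L))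
  (B 1 3 (B 2 4 (B 1 5 L (B 2 5 L (B 3 5 L L))) L) L))) (B 1 4 (B 2 5 (B 1 3 L
  (B 1 5 (B 3 4 L (B 3 5 L L)) L)) (B 1 5 (B 2 4 (B 1 3 L (B 3 4 L (B 3 5 L
  L))) L) L)) (B 1 3 (B 1 5 (B 2 4 L L) L) L))) (B 1 5 (B 2 5 (B 1 4 (B 1 3 L
  (B 3 4 L (B 3 5 L L))) (B 1 2 (B 3 4 L (B 1 3 (B 2 4 L L) L)) (B 1 3 (B 2 4
  L L) L))) (B 3 5 (B 1 2 (B 1 4 L (B 3 4 L (B 1 3 (B 2 4 L L) L))) (B 2 4 (B
  1 3 L (B 1 4 L L)) L)) L)) (B 2 5 (B 3 5 (B 1 4 (B 1 2 L (B 1 3 L L)) (B 1 2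
  (B 1 3 (B 2 4 L (B 3 4 L L)) L) L)) L) L))) (B 1 4 (B 2 4 (B 1 5 (B 3 5 L (B
  0 5 (B 1 3 L (B 3 4 L L)) (B 2 5 (B 1 3 L (B 3 4 L L)) L))) (B 2 5 (B 1 3 (B
  0 5 L (B 3 5 L L)) (B 1 2 (B 3 5 L L) L)) (B 0 5 (B 1 2 (B 3 5 L L) L) L)))
  (B 3 4 (B 2 5 (B 1 5 L (B 1 3 (B 0 5 L (B 3 5 L L)) (B 1 2 (B 3 5 L L) L)))
  (B 1 2 (B 0 5 (B 1 5 L (B 3 5 L L)) (B 1 5 (B 3 5 L L) L)) L)) L)) (B 2 4 (B
  3 4 (B 1 2 (B 1 5 (B 0 5 L (B 2 5 L (B 3 5 L L))) (B 1 3 (B 0 5 (B 2 5 L (B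
  3 5 L L)) (B 2 5 (B 3 5 L L) L)) L)) (B 1 3 (B 1 5 (B 0 5 L (B 2 5 L (B 3 5
  L L))) L) L)) L) L))) (B 3 4 (B 0 5 (B 1 3 (B 1 4 (B 2 5 L (B 1 2 (B 1 5 L
  (B 3 5 L L)) (B 1 5 (B 2 4 L L) L))) (B 2 4 (B 1 5 L (B 1 2 (B 2 5 L (B 3 5
  L L)) L)) (B 0 4 (B 1 2 (B 1 5 L (B 2 5 L (B 3 5 L L))) L) L))) (B 3 5 (B 1
  2 (B 1 4 L (B 1 5 (B 0 4 L (B 2 4 L L)) L)) (B 1 4 (B 1 5 (B 2 4 L (B 2 5 L
  L)) L) L)) L)) (B 0 4 (B 3 5 (B 1 5 (B 1 2 L (B 1 4 (B 2 4 L (B 2 5 L L)) (B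
  1 3 (B 2 4 L L) L))) (B 2 5 (B 1 2 (B 1 3 L (B 1 4 L L)) (B 1 3 (B 1 4 L L)
  L)) L)) L) L)) (B 0 4 (B 1 3 (B 3 5 (B 1 4 (B 2 5 L (B 1 2 (B 0 5 L (B 1 5 L
  L)) (B 1 5 (B 2 4 L L) L))) (B 2 4 (B 1 5 L (B 1 2 (B 0 5 L (B 2 5 L L)) L))
  L)) L) L) L))) (B 0 4 (B 2 5 (B 0 3 (B 1 2 (B 1 4 (B 3 5 L (B 1 3 (B 0 5 L
  (B 1 5 L L)) (B 1 5 (B 3 4 L L) L))) (B 3 4 (B 1 5 L (B 1 3 (B 0 5 L (B 3 5
  L L)) L)) (B 1 3 (B 2 4 (B 0 5 L (B 1 5 L (B 3 5 L L))) L) L))) (B 2 4 (B 1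
  3 (B 1 5 L (B 1 4 (B 0 5 L (B 3 5 L L)) L)) (B 1 4 (B 1 5 (B 3 4 L (B 3 5 L
  L)) L) L)) L)) (B 0 5 (B 1 3 (B 1 2 (B 3 4 L (B 3 5 (B 1 4 L (B 2 4 L L))
  L)) (B 2 4 (B 1 4 (B 3 4 L (B 3 5 L L)) (B 1 5 (B 3 4 L (B 3 5 L L)) L)) L))
  (B 3 4 (B 3 5 (B 1 2 (B 1 4 L (B 1 5 L L)) (B 1 4 (B 1 5 (B 2 4 L L) L) L))
  L) L)) L)) (B 0 5 (B 1 2 (B 2 4 (B 3 5 (B 1 3 L (B 1 4 (B 0 3 L (B 3 4 L L))
  (B 1 5 (B 3 4 L L) L))) (B 1 5 (B 0 3 (B 1 3 L (B 3 4 L L)) (B 1 3 (B 3 4 L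
  L) L)) L)) L) L) L)) (B 0 3 (B 0 5 (B 2 4 (B 1 2 (B 1 4 (B 3 5 L (B 1 3 (B 1
  5 L (B 2 5 L L)) (B 1 5 (B 3 4 L L) L))) (B 3 4 (B 1 5 L (B 1 3 (B 2 5 L (B
  3 5 L L)) L)) L)) (B 2 5 (B 1 4 (B 1 3 L (B 1 5 (B 3 4 L (B 3 5 L L)) L)) (B
  1 3 (B 1 5 (B 3 4 L L) L) L)) L)) L) L) L)).

Definition plan7 : plan :=
  B 0 6 (B 1 6 L (B 1 2 (B 1 3 L (B 3 6 L (B 1 4 (B 1 5 L (B 3 5 L (B 5 6 L
  L))) (B 3 4 (B 1 5 L (B 3 5 L (B 5 6 L L))) (B 4 6 (B 1 5 L (B 3 5 L L))
  L))))) (B 1 4 (B 1 5 L (B 5 6 L (B 2 5 (B 1 3 L (B 3 5 L (B 3 6 L L))) (B 2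
  6 (B 1 3 L (B 3 5 L L)) L)))) (B 1 3 (B 2 6 L (B 2 4 (B 1 5 L (B 2 5 L (B 5
  6 L L))) (B 4 6 (B 1 5 L (B 2 5 L L)) L))) (B 1 5 (B 4 6 L (B 2 4 (B 3 4 L
  (B 3 6 L L)) (B 2 6 (B 3 4 L L) L))) L))))) (B 2 6 (B 3 6 L (B 0 3 (B 1 3 L
  (B 1 6 L (B 4 6 (B 1 5 L (B 3 5 L (B 5 6 L L))) (B 5 6 (B 1 4 L (B 3 4 L L))
  L)))) (B 3 4 (B 3 5 L (B 5 6 L (B 0 5 (B 1 3 L (B 1 5 L (B 1 6 L L))) L)))
  (B 4 6 (B 3 5 L (B 1 3 (B 0 5 L (B 0 4 (B 5 6 L L) L)) L)) (B 0 4 (B 1 3 (B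
  0 5 L (B 3 5 L (B 5 6 L L))) (B 1 6 (B 0 5 L (B 3 5 L L)) L)) L))))) (B 4 6
  (B 5 6 L (B 1 6 (B 0 5 L (B 0 2 (B 0 3 L (B 3 5 L (B 3 6 L L))) (B 2 5 (B 0
  3 L (B 0 4 (B 3 5 L (B 3 6 L L)) L)) L))) (B 3 6 (B 2 5 L (B 0 2 (B 1 2 L (B
  1 5 L L)) (B 0 5 (B 1 2 L L) L))) L))) (B 1 6 (B 3 6 (B 0 2 L (B 0 4 (B 0 5
  L (B 2 5 L (B 5 6 L L))) (B 2 4 (B 0 5 L (B 0 3 (B 2 5 L (B 5 6 L L)) L))
  L))) (B 5 6 (B 0 4 L (B 0 2 (B 0 3 L (B 3 4 L L)) (B 0 3 (B 2 4 L L) L)))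
  L)) (B 3 6 (B 5 6 (B 2 4 L (B 0 2 (B 1 2 L (B 1 4 L L)) (B 0 4 (B 1 2 L L)
  L))) L) L)))).

Definition plan7a : plan :=
  B 0 2 (B 3 4 (B 0 5 L (B 1 5 L (B 5 6 L (B 3 5 (B 0 3 L (B 0 4 L (B 1 3 L (B
  1 4 L (B 3 6 L (B 4 6 L L)))))) (B 2 5 (B 0 3 L (B 1 3 L (B 3 6 L L)))
  L))))) (B 3 5 (B 0 4 L (B 1 4 L (B 4 6 L (B 2 4 (B 0 3 L (B 1 3 L (B 3 6 L
  L))) L)))) (B 0 3 (B 0 4 (B 0 5 L (B 1 5 L (B 2 5 L (B 5 6 L L)))) (B 1 4 (B
  0 5 L (B 1 5 L (B 2 5 L (B 5 6 L L)))) (B 2 4 (B 0 5 L (B 1 5 L (B 2 5 L (B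
  5 6 L L)))) (B 4 6 (B 0 5 L (B 1 5 L (B 2 5 L (B 5 6 L L)))) L)))) (B 1 3 (B
  0 4 (B 0 5 L (B 1 5 L (B 2 5 L (B 5 6 L L)))) (B 1 4 (B 0 5 L (B 1 5 L (B 2
  5 L (B 5 6 L L)))) (B 2 4 (B 0 5 L (B 1 5 L (B 2 5 L (B 5 6 L L)))) (B 4 6
  (B 0 5 L (B 1 5 L (B 2 5 L (B 5 6 L L)))) L)))) (B 3 6 (B 0 4 (B 0 5 L (B 1
  5 L (B 2 5 L (B 5 6 L L)))) (B 1 4 (B 0 5 L (B 1 5 L (B 2 5 L (B 5 6 L L))))
  (B 2 4 (B 0 5 L (B 1 5 L (B 2 5 L (B 5 6 L L)))) (B 4 6 (B 0 5 L (B 1 5 L (B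
  2 5 L (B 5 6 L L)))) L)))) L))))) (B 0 3 (B 2 4 (B 0 5 L (B 1 5 L (B 5 6 L
  (B 2 5 (B 0 4 L (B 1 2 L (B 1 4 L (B 2 6 L (B 4 6 L L))))) (B 3 5 (B 1 2 L
  (B 2 6 L L)) L))))) (B 2 5 (B 0 4 L (B 1 4 L (B 4 6 L (B 3 4 (B 1 2 L (B 2 6
  L L)) L)))) (B 1 2 (B 0 4 (B 0 5 L (B 1 5 L (B 3 5 L (B 5 6 L L)))) (B 1 4
  (B 0 5 L (B 1 5 L (B 3 5 L (B 5 6 L L)))) (B 3 4 (B 0 5 L (B 1 5 L (B 3 5 L
  (B 5 6 L L)))) (B 4 6 (B 0 5 L (B 1 5 L (B 3 5 L (B 5 6 L L)))) L)))) (B 2 6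
  (B 0 4 (B 0 5 L (B 1 5 L (B 3 5 L (B 5 6 L L)))) (B 1 4 (B 0 5 L (B 1 5 L (B
  3 5 L (B 5 6 L L)))) (B 3 4 (B 0 5 L (B 1 5 L (B 3 5 L (B 5 6 L L)))) (B 4 6
  (B 0 5 L (B 1 5 L (B 3 5 L (B 5 6 L L)))) L)))) L)))) (B 0 4 (B 2 5 (B 1 3 L
  (B 3 6 L (B 3 5 (B 0 5 L (B 1 2 L (B 1 5 L (B 2 6 L (B 5 6 L L))))) (B 3 4
  (B 0 5 L (B 1 5 L (B 5 6 L L))) L)))) (B 3 5 (B 1 2 L (B 2 6 L (B 2 4 (B 0 5
  L (B 1 5 L (B 5 6 L L))) L))) (B 0 5 (B 1 2 (B 1 3 L (B 3 4 L (B 3 6 L L)))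
  (B 2 4 (B 1 3 L (B 3 4 L (B 3 6 L L))) (B 2 6 (B 1 3 L (B 3 4 L (B 3 6 L
  L))) L))) (B 1 5 (B 1 2 (B 1 3 L (B 3 4 L (B 3 6 L L))) (B 2 4 (B 1 3 L (B 3
  4 L (B 3 6 L L))) (B 2 6 (B 1 3 L (B 3 4 L (B 3 6 L L))) L))) (B 5 6 (B 1 2
  (B 1 3 L (B 3 4 L (B 3 6 L L))) (B 2 4 (B 1 3 L (B 3 4 L (B 3 6 L L))) (B 2
  6 (B 1 3 L (B 3 4 L (B 3 6 L L))) L))) L))))) (B 0 5 (B 2 4 (B 1 3 L (B 3 6
  L (B 3 4 (B 1 2 L (B 1 4 L (B 2 6 L (B 4 6 L L)))) (B 3 5 (B 1 4 L (B 4 6 L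
  L)) L)))) (B 3 4 (B 1 2 L (B 2 6 L (B 2 5 (B 1 4 L (B 4 6 L L)) L))) (B 1 4
  (B 1 2 (B 1 3 L (B 3 5 L (B 3 6 L L))) (B 2 5 (B 1 3 L (B 3 5 L (B 3 6 L
  L))) (B 2 6 (B 1 3 L (B 3 5 L (B 3 6 L L))) L))) (B 4 6 (B 1 2 (B 1 3 L (B 3
  5 L (B 3 6 L L))) (B 2 5 (B 1 3 L (B 3 5 L (B 3 6 L L))) (B 2 6 (B 1 3 L (B
  3 5 L (B 3 6 L L))) L))) L)))) (B 1 2 (B 3 4 (B 1 5 L (B 5 6 L (B 3 5 (B 1 3
  L (B 1 4 L (B 3 6 L (B 4 6 L L)))) (B 2 5 (B 1 3 L (B 3 6 L L)) L)))) (B 3 5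
  (B 1 4 L (B 4 6 L (B 2 4 (B 1 3 L (B 3 6 L L)) L))) (B 1 3 (B 1 4 (B 1 5 L
  (B 2 5 L (B 5 6 L L))) (B 2 4 (B 1 5 L (B 2 5 L (B 5 6 L L))) (B 4 6 (B 1 5
  L (B 2 5 L (B 5 6 L L))) L))) (B 3 6 (B 1 4 (B 1 5 L (B 2 5 L (B 5 6 L L)))
  (B 2 4 (B 1 5 L (B 2 5 L (B 5 6 L L))) (B 4 6 (B 1 5 L (B 2 5 L (B 5 6 L
  L))) L))) L)))) (B 1 3 (B 2 4 (B 1 5 L (B 5 6 L (B 2 5 (B 1 4 L (B 2 6 L (B
  4 6 L L))) (B 2 6 (B 3 5 L L) L)))) (B 2 5 (B 1 4 L (B 4 6 L (B 2 6 (B 3 4 L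
  L) L))) (B 2 6 (B 1 4 (B 1 5 L (B 3 5 L (B 5 6 L L))) (B 3 4 (B 1 5 L (B 3 5
  L (B 5 6 L L))) (B 4 6 (B 1 5 L (B 3 5 L (B 5 6 L L))) L))) L))) (B 1 4 (B 2
  5 (B 3 6 L (B 3 5 (B 1 5 L (B 2 6 L (B 5 6 L L))) (B 3 4 (B 1 5 L (B 5 6 L
  L)) L))) (B 2 6 (B 3 5 L (B 1 5 (B 3 4 L (B 3 6 L L)) (B 5 6 (B 3 4 L (B 3 6
  L L)) L))) (B 2 4 (B 1 5 (B 3 4 L (B 3 5 L (B 3 6 L L))) (B 5 6 (B 3 4 L (B
  3 5 L (B 3 6 L L))) L)) L))) (B 1 5 (B 2 4 (B 3 6 L (B 3 4 (B 2 6 L (B 4 6 L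
  L)) (B 3 5 (B 4 6 L L) L))) (B 2 6 (B 3 4 L (B 4 6 (B 3 5 L (B 3 6 L L)) L))
  (B 2 5 (B 4 6 (B 3 4 L (B 3 5 L (B 3 6 L L))) L) L))) (B 2 4 (B 3 6 (B 5 6 L
  (B 2 5 (B 2 6 L (B 4 6 L L)) (B 2 6 (B 3 5 L L) L))) (B 3 4 (B 5 6 (B 2 6 L
  (B 4 6 L L)) (B 3 5 (B 2 6 (B 4 6 L L) (B 2 5 (B 4 6 L L) L)) L)) (B 3 5 (B
  4 6 (B 2 6 L (B 5 6 L (B 2 5 L L))) L) L))) (B 2 6 (B 3 4 (B 5 6 L (B 3 5 (B
  3 6 L (B 4 6 L L)) (B 2 5 (B 3 6 L L) L))) (B 4 6 (B 3 5 L (B 3 6 (B 2 5 L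
  (B 5 6 L L)) L)) L)) (B 2 5 (B 4 6 (B 3 6 L (B 3 5 (B 5 6 L L) (B 3 4 (B 5 6
  L L) L))) L) L)))))))))).

Definition plan7b : plan :=
  B 0 4 (B 0 5 L (B 1 5 L (B 2 5 L (B 3 5 L (B 5 6 L L))))) (B 1 4 (B 0 5 L (B
  1 5 L (B 2 5 L (B 3 5 L (B 5 6 L L))))) (B 2 4 (B 0 5 L (B 1 5 L (B 2 5 L (B
  3 5 L (B 5 6 L L))))) (B 3 4 (B 0 5 L (B 1 5 L (B 2 5 L (B 3 5 L (B 5 6 L
  L))))) (B 4 6 (B 0 5 L (B 1 5 L (B 2 5 L (B 3 5 L (B 5 6 L L))))) L)))).

Definition plan8 : plan :=
  B 6 7 L (B 0 6 (B 1 6 L (B 1 7 L (B 2 7 (B 1 3 L (B 3 6 L (B 3 7 L (B 1 4 (B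
  1 5 L (B 3 5 L (B 5 6 (B 0 3 L (B 0 4 L (B 0 5 L (B 0 7 L (B 3 4 L (B 4 6 L
  (B 4 7 L L))))))) L))) (B 3 4 (B 1 5 L (B 3 5 L (B 5 6 L L))) (B 4 6 (B 3 5
  L (B 4 7 (B 1 5 L (B 5 6 L L)) L)) L)))))) (B 4 7 (B 1 5 L (B 5 6 L (B 5 7 L
  (B 1 2 (B 1 3 L (B 3 5 L (B 3 6 (B 0 2 L (B 0 3 L (B 0 5 L (B 0 7 L (B 2 5 L
  L))))) L))) (B 2 5 (B 1 3 L (B 3 5 L (B 3 6 L L))) L))))) (B 3 7 (B 1 2 L (B
  2 6 L (B 1 4 (B 1 5 L (B 2 5 L (B 5 6 (B 0 2 L (B 0 4 L (B 0 5 L (B 0 7 L (B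
  2 4 L L))))) L))) (B 2 4 (B 1 5 L (B 2 5 L (B 5 6 L L))) L)))) (B 0 7 (B 5 7
  (B 1 4 L (B 4 6 L (B 1 2 (B 1 3 L (B 3 4 L L)) (B 1 3 (B 2 4 L L) L)))) L)
  L)))))) (B 0 7 (B 1 6 L (B 1 7 L (B 2 6 (B 1 3 L (B 3 6 L (B 3 7 L (B 4 6 (B
  1 5 L (B 5 6 L (B 3 5 (B 1 2 L (B 1 4 L (B 2 4 L (B 2 5 L (B 2 7 L (B 3 4 L
  (B 4 7 L L))))))) L))) (B 5 6 (B 1 4 L (B 3 4 (B 1 2 L (B 1 5 L (B 2 4 L (B
  2 5 L (B 2 7 L (B 3 5 L (B 4 7 L L))))))) L)) L))))) (B 4 6 (B 1 5 L (B 5 6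
  L (B 3 6 (B 1 2 L (B 2 5 (B 1 3 L (B 1 4 L (B 2 4 L (B 2 7 L (B 3 4 L (B 3 5
  L (B 3 7 L (B 4 7 L L)))))))) L)) L))) (B 3 6 (B 1 2 L (B 2 7 L (B 5 6 (B 1
  4 L (B 2 4 (B 1 3 L (B 1 5 L (B 2 5 L (B 3 4 L (B 3 5 L (B 3 7 L (B 4 7 L
  L))))))) L)) L))) L))))) (B 2 6 (B 3 6 L (B 3 7 L (B 4 7 (B 3 5 L (B 5 6 L
  (B 5 7 L (B 0 3 (B 1 3 L (B 1 5 L (B 1 6 (B 0 2 L (B 0 5 L (B 1 2 L (B 1 7 L
  L)))) L))) (B 0 5 (B 1 3 L (B 1 5 L (B 1 6 L L))) L))))) (B 5 7 (B 3 4 L (B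
  4 6 L (B 0 3 (B 1 3 L (B 1 4 L (B 1 6 (B 0 2 L (B 0 4 L (B 1 2 L (B 1 7 L
  L)))) L))) (B 0 4 (B 1 3 L (B 1 4 L (B 1 6 L L))) L)))) (B 1 7 (B 0 3 L (B 2
  7 (B 0 4 (B 0 5 L (B 3 5 L L)) (B 0 5 (B 3 4 L L) L)) L)) L))))) (B 2 7 (B 3
  6 L (B 3 7 L (B 4 6 (B 3 5 L (B 5 6 L (B 1 6 (B 0 3 L (B 0 5 (B 0 4 L (B 1 3
  L (B 1 4 L (B 1 5 L (B 1 7 L (B 3 4 L (B 4 7 L L))))))) L)) L))) (B 1 6 (B 0
  3 L (B 5 6 (B 3 4 L (B 0 4 (B 0 5 L (B 1 3 L (B 1 4 L (B 1 5 L (B 1 7 L (B 3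
  5 L (B 4 7 L L))))))) L)) L)) L)))) (B 4 6 (B 5 6 L (B 5 7 L (B 1 7 (B 0 5 L
  (B 0 2 (B 0 3 L (B 3 5 L (B 3 6 L L))) (B 2 5 (B 0 3 L (B 3 5 L (B 3 6 (B 0
  4 L (B 2 4 L (B 3 4 L (B 3 7 L L)))) L))) L))) (B 3 7 (B 2 5 L (B 4 7 (B 0 2
  (B 1 2 L (B 1 5 L L)) (B 0 5 (B 1 2 L L) L)) L)) L)))) (B 5 6 (B 4 7 L (B 1
  7 (B 0 4 L (B 0 2 (B 0 3 L (B 3 4 L (B 3 6 L L))) (B 2 4 (B 0 3 L (B 3 4 L
  (B 3 6 (B 0 5 L (B 2 5 L (B 3 5 L (B 3 7 L L)))) L))) L))) (B 3 7 (B 2 4 L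
  (B 5 7 (B 0 2 (B 1 2 L (B 1 4 L L)) (B 0 4 (B 1 2 L L) L)) L)) L))) (B 1 6
  (B 3 6 (B 0 2 (B 0 3 L (B 1 2 L (B 1 3 L (B 1 7 L (B 3 7 L (B 4 7 (B 0 5 L
  (B 1 5 L (B 2 5 L (B 3 5 L (B 5 7 L L))))) L)))))) (B 0 4 (B 0 5 L (B 2 5 (B
  1 3 L (B 1 4 L (B 1 7 L (B 2 4 L (B 3 5 L (B 3 7 L (B 4 7 L L))))))) L)) (B
  0 5 (B 2 4 (B 1 3 L (B 1 5 L (B 1 7 L (B 2 5 L (B 3 4 L (B 3 7 L (B 4 7 L
  L))))))) L) L))) L) L))))))).

Definition plan8a : plan :=
  B 6 7 L (B 0 7 L (B 1 7 L (B 2 7 (B 0 3 L (B 1 3 L (B 3 6 L (B 3 4 (B 0 5 L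
  (B 1 5 L (B 5 6 L (B 5 7 (B 0 2 L (B 0 4 L (B 1 2 L (B 1 4 L (B 2 6 L (B 4 6
  L L)))))) (B 3 5 (B 0 4 L (B 1 4 L (B 4 6 L (B 3 7 (B 0 2 L (B 1 2 L (B 2 6
  L L))) (B 4 7 (B 0 2 L (B 1 2 L (B 2 6 L L))) L))))) (B 3 7 (B 0 2 L (B 1 2
  L (B 2 6 L (B 2 5 (B 0 4 L (B 1 4 L (B 4 6 L L))) L)))) L)))))) (B 3 5 (B 0
  4 L (B 1 4 L (B 4 6 L (B 4 7 (B 0 2 L (B 0 5 L (B 1 2 L (B 1 5 L (B 2 6 L (B
  5 6 L L)))))) (B 3 7 (B 0 2 L (B 1 2 L (B 2 6 L (B 2 4 (B 0 5 L (B 1 5 L (B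
  5 6 L L))) L)))) L))))) (B 3 7 (B 0 2 L (B 1 2 L (B 2 6 L (B 2 4 (B 0 5 L (B
  1 5 L (B 5 6 L (B 2 5 (B 0 4 L (B 1 4 L (B 4 6 L L))) (B 5 7 (B 0 4 L (B 1 4
  L (B 4 6 L L))) L))))) (B 2 5 (B 0 4 L (B 1 4 L (B 4 6 L (B 4 7 (B 0 5 L (B
  1 5 L (B 5 6 L L))) L)))) (B 4 7 (B 0 5 L (B 1 5 L (B 5 6 L (B 5 7 (B 0 4 L
  (B 1 4 L (B 4 6 L L))) L)))) (B 5 7 (B 0 4 L (B 1 4 L (B 4 6 L L))) (B 0 4
  (B 0 5 L (B 1 5 L (B 5 6 L L))) (B 1 4 (B 0 5 L (B 1 5 L (B 5 6 L L))) (B 4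
  6 (B 0 5 L (B 1 5 L (B 5 6 L L))) L)))))))))) (B 4 7 (B 0 5 L (B 1 5 L (B 5
  6 L (B 5 7 (B 0 4 L (B 1 4 L (B 4 6 L L))) L)))) (B 5 7 (B 0 4 L (B 1 4 L (B
  4 6 L L))) L)))))))) (B 3 7 (B 0 2 L (B 1 2 L (B 2 6 L (B 2 4 (B 0 5 L (B 1
  5 L (B 5 6 L (B 5 7 (B 0 3 L (B 0 4 L (B 1 3 L (B 1 4 L (B 3 6 L (B 4 6 L
  L)))))) (B 2 5 (B 0 4 L (B 1 4 L (B 4 6 L (B 4 7 (B 0 3 L (B 1 3 L (B 3 6 L
  L))) L)))) L))))) (B 2 5 (B 0 4 L (B 1 4 L (B 4 6 L (B 4 7 (B 0 3 L (B 0 5 L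
  (B 1 3 L (B 1 5 L (B 3 6 L (B 5 6 L L)))))) L)))) (B 4 7 (B 0 5 L (B 1 5 L
  (B 5 6 L (B 5 7 (B 0 4 L (B 1 4 L (B 4 6 L L))) L)))) (B 5 7 (B 0 4 L (B 1 4
  L (B 4 6 L L))) L))))))) (B 4 7 (B 0 5 L (B 1 5 L (B 5 6 L (B 2 5 (B 0 3 L
  (B 1 3 L (B 3 6 L (B 3 5 (B 0 2 L (B 1 2 L (B 2 6 L (B 5 7 (B 0 4 L (B 1 4 L
  (B 4 6 L L))) L)))) (B 5 7 (B 0 4 L (B 1 4 L (B 4 6 L (B 3 4 (B 0 2 L (B 1 2
  L (B 2 6 L L))) L)))) L))))) (B 3 5 (B 0 2 L (B 1 2 L (B 2 6 L (B 5 7 (B 0 4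
  L (B 1 4 L (B 4 6 L (B 2 4 (B 0 3 L (B 1 3 L (B 3 6 L L))) L)))) L)))) (B 5
  7 (B 0 4 L (B 1 4 L (B 4 6 L (B 2 4 (B 0 3 L (B 1 3 L (B 3 6 L (B 3 4 (B 0 2
  L (B 1 2 L (B 2 6 L L))) L)))) (B 3 4 (B 0 2 L (B 1 2 L (B 2 6 L L))) (B 0 2
  (B 0 3 L (B 1 3 L (B 3 6 L L))) (B 1 2 (B 0 3 L (B 1 3 L (B 3 6 L L))) (B 2
  6 (B 0 3 L (B 1 3 L (B 3 6 L L))) L)))))))) L)))))) (B 5 7 (B 0 4 L (B 1 4 L
  (B 4 6 L (B 2 4 (B 0 3 L (B 1 3 L (B 3 6 L (B 3 4 (B 0 2 L (B 1 2 L (B 2 6 L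
  L))) L)))) (B 3 4 (B 0 2 L (B 1 2 L (B 2 6 L L))) L))))) L)))))).

Definition plan9 : plan :=
  B 7 8 L (B 6 8 L (B 6 7 L (B 0 6 (B 1 7 L (B 1 8 L (B 2 7 (B 1 3 L (B 3 6 L
  (B 3 8 L (B 4 8 (B 1 5 L (B 3 5 L (B 5 6 L (B 1 6 (B 0 3 L (B 0 5 L (B 0 7 L
  (B 0 8 L (B 5 7 L (B 3 7 (B 0 2 L (B 1 2 L (B 2 5 L (B 2 6 L (B 2 8 L (B 5 8
  (B 0 4 L (B 1 4 L (B 2 4 L (B 3 4 L (B 4 6 L (B 4 7 L L)))))) L))))))
  L)))))) L)))) (B 5 8 (B 1 4 L (B 3 4 L L)) (B 0 8 (B 1 6 L (B 2 8 (B 3 7 L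
  (B 1 4 (B 3 5 L (B 1 5 (B 3 4 L L) L)) (B 1 5 (B 3 4 L L) L))) L)) L))))))
  (B 2 8 (B 1 3 L (B 3 6 L (B 3 7 L (B 4 7 (B 1 5 L (B 3 5 L (B 5 6 L (B 1 6
  (B 0 3 L (B 0 5 L (B 0 7 L (B 0 8 L (B 5 7 (B 0 4 L (B 1 4 L (B 3 4 L (B 4 6
  L (B 4 8 L (B 3 8 (B 0 2 L (B 1 2 L (B 2 4 L (B 2 5 L (B 2 6 L (B 5 8 L
  L)))))) L)))))) L))))) L)))) (B 0 7 (B 1 6 L (B 5 7 (B 1 4 L (B 1 2 (B 3 4 L
  L) L)) L)) L))))) (B 4 7 (B 1 5 L (B 5 6 L (B 5 8 L (B 3 8 (B 1 2 L (B 2 5 L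
  L)) (B 0 8 (B 1 6 L (B 4 8 (B 5 7 L (B 1 2 (B 3 5 L (B 1 3 (B 2 5 L L) L))
  (B 1 3 (B 2 5 L L) L))) L)) L))))) (B 5 7 (B 1 4 L (B 4 6 L (B 4 8 L (B 3 8
  (B 1 2 L (B 2 4 L L)) (B 0 8 (B 1 6 L (B 5 8 (B 1 2 (B 3 4 L (B 1 3 (B 2 4 L
  L) L)) (B 1 3 (B 2 4 L L) L)) L)) L))))) (B 0 7 (B 1 6 L (B 3 7 (B 1 2 L (B
  2 6 L (B 1 4 (B 2 5 L (B 1 5 (B 2 4 L L) L)) (B 1 5 (B 2 4 L L) L)))) L))
  L))))))) (B 0 7 (B 1 6 L (B 1 8 L (B 2 6 (B 1 3 L (B 3 7 L (B 3 8 L (B 4 8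
  (B 1 5 L (B 3 5 L (B 5 6 L (B 3 6 (B 1 2 L (B 2 5 L (B 2 7 L (B 2 8 L (B 5 7
  L (B 1 7 (B 0 2 L (B 0 3 L (B 0 5 L (B 0 8 L (B 5 8 (B 0 4 L (B 1 4 L (B 2 4
  L (B 3 4 L (B 4 6 L (B 4 7 L L)))))) L))))) L)))))) L)))) (B 5 8 (B 1 4 L (B
  3 4 L L)) (B 0 8 (B 1 7 L (B 2 8 (B 3 6 L (B 1 4 (B 3 5 L (B 1 5 (B 3 4 L L)
  L)) (B 1 5 (B 3 4 L L) L))) L)) L)))))) (B 3 6 (B 1 2 L (B 2 7 L (B 2 8 L (B
  4 6 (B 1 5 L (B 5 7 L (B 5 8 L (B 2 5 (B 1 3 L (B 1 4 L (B 3 7 L (B 1 7 (B 0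
  2 L (B 0 3 L (B 0 4 L (B 0 5 L (B 0 8 L (B 3 8 L L)))))) L)))) L)))) (B 5 6
  (B 1 4 L (B 2 4 (B 1 3 L (B 1 5 L (B 3 7 L (B 3 8 L (B 4 7 L (B 1 7 (B 0 2 L
  (B 0 3 L (B 0 4 L (B 0 5 L (B 0 8 L (B 4 8 L L)))))) L)))))) L)) L))))) (B 4
  6 (B 1 5 L (B 5 6 (B 1 4 L (B 4 7 L (B 4 8 L (B 5 7 L (B 5 8 L (B 2 8 (B 1 3
  L (B 3 4 L (B 3 5 L (B 3 7 L (B 1 7 (B 0 3 L (B 0 4 L (B 0 5 L (B 0 8 L (B 3
  8 (B 0 2 L (B 1 2 L (B 2 4 L (B 2 5 L (B 2 7 L L))))) L))))) L))))) (B 0 8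
  (B 1 2 (B 1 7 L (B 3 4 L (B 3 5 L (B 3 7 L (B 1 3 (B 2 4 L (B 2 5 L (B 2 7 L
  L))) L))))) L) L))))))) L)) L))))) (B 0 8 (B 1 6 L (B 1 7 L (B 2 6 (B 1 3 L
  (B 3 7 L (B 3 8 L (B 4 7 (B 1 5 L (B 3 5 L (B 5 6 L (B 3 6 (B 1 2 L (B 2 5 L
  (B 2 7 L (B 2 8 L (B 5 7 (B 1 4 L (B 2 4 L (B 3 4 L (B 4 6 L (B 4 8 L (B 1 8
  (B 0 2 L (B 0 3 L (B 0 4 L (B 0 5 L (B 5 8 L L))))) L)))))) L))))) L)))) (B
  2 7 (B 3 6 L (B 5 7 (B 1 4 L (B 3 4 L L)) L)) L))))) (B 3 6 (B 1 2 L (B 2 7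
  L (B 2 8 L (B 4 7 (B 1 5 L (B 2 5 L (B 5 6 L L))) (B 3 7 (B 5 7 (B 1 4 L (B
  2 4 L L)) L) L))))) (B 4 6 (B 1 5 L (B 5 6 (B 1 4 L (B 4 7 L (B 4 8 L (B 5 7
  L (B 2 7 (B 1 3 L (B 3 4 L (B 3 5 L (B 3 7 (B 1 2 L (B 2 4 L (B 2 5 L (B 2 8
  L (B 1 8 (B 0 2 L (B 0 3 L (B 0 4 L (B 0 5 L (B 3 8 L (B 5 8 L L))))))
  L))))) L)))) L))))) L)) L))))) (B 2 6 (B 3 7 L (B 3 8 L (B 4 7 (B 3 5 L (B 5
  6 L (B 5 8 L (B 1 8 (B 0 3 L (B 0 5 L L)) (B 2 8 (B 3 6 L (B 4 8 (B 5 7 L (B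
  0 3 (B 1 5 L (B 0 5 (B 1 3 L L) L)) (B 0 5 (B 1 3 L L) L))) L)) L))))) (B 5
  7 (B 3 4 L (B 4 6 L (B 4 8 L (B 1 8 (B 0 3 L (B 0 4 L L)) (B 2 8 (B 3 6 L (B
  5 8 (B 0 3 (B 1 4 L (B 0 4 (B 1 3 L L) L)) (B 0 4 (B 1 3 L L) L)) L)) L)))))
  (B 1 7 (B 0 3 L (B 2 7 (B 3 6 L (B 0 4 (B 3 5 L (B 0 5 (B 3 4 L L) L)) (B 0
  5 (B 3 4 L L) L))) L)) L))))) (B 2 7 (B 3 6 L (B 3 8 L (B 4 6 (B 3 5 L (B 5
  7 L (B 5 8 L (B 1 8 (B 0 3 L (B 0 5 L L)) (B 2 8 (B 3 7 L (B 4 8 (B 5 6 L (B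
  1 6 (B 0 3 L (B 0 5 L L)) L)) L)) L))))) (B 1 6 (B 0 3 L (B 5 6 (B 3 4 L (B
  0 4 (B 1 3 L (B 1 7 L (B 1 8 L (B 3 5 L (B 4 7 L (B 3 7 (B 0 2 L (B 1 2 L (B
  2 4 L (B 2 5 L (B 2 8 L (B 4 8 L L)))))) L)))))) L)) L)) L)))) (B 2 8 (B 3 6
  L (B 3 7 L (B 4 6 (B 3 5 L (B 5 7 L (B 1 7 (B 0 3 L (B 0 5 L L)) L))) (B 1 6
  (B 0 3 L (B 5 6 (B 3 4 L (B 0 4 (B 1 3 L (B 1 7 L (B 1 8 L (B 3 5 L (B 4 7 L
  L))))) L)) L)) L)))) (B 4 6 (B 5 7 L (B 5 8 L (B 1 7 (B 0 5 L (B 3 8 (B 0 2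
  L (B 2 5 L L)) (B 1 8 (B 4 8 (B 5 6 L (B 0 2 (B 3 5 L (B 0 3 (B 2 5 L L) L))
  (B 0 3 (B 2 5 L L) L))) L) L))) (B 3 7 (B 2 5 L (B 4 7 (B 5 6 L (B 0 2 (B 1
  5 L (B 0 5 (B 1 2 L L) L)) (B 0 5 (B 1 2 L L) L))) L)) L)))) (B 5 6 (B 4 7 L
  (B 4 8 L (B 1 7 (B 0 4 L (B 3 8 (B 0 2 L (B 2 4 L L)) (B 1 8 (B 5 8 (B 0 2
  (B 3 4 L (B 0 3 (B 2 4 L L) L)) (B 0 3 (B 2 4 L L) L)) L) L))) (B 3 7 (B 2 4
  L (B 5 7 (B 0 2 (B 1 4 L (B 0 4 (B 1 2 L L) L)) (B 0 4 (B 1 2 L L) L)) L))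
  L)))) (B 1 6 (B 3 6 (B 0 2 (B 1 7 L (B 1 8 L (B 3 7 L (B 3 8 L (B 4 7 (B 0 5
  L (B 1 5 L (B 2 5 L (B 3 5 L (B 4 8 (B 5 7 L L) L))))) L))))) (B 0 4 (B 5 7
  L (B 5 8 L (B 2 5 (B 1 7 L (B 1 8 L (B 3 7 L L))) (B 0 5 (B 2 4 (B 1 7 L (B
  1 2 (B 1 8 L (B 3 7 L L)) L)) L) L)))) (B 0 5 (B 2 4 (B 1 7 L (B 1 8 L (B 3
  7 L (B 3 8 L (B 4 7 L L))))) L) L))) L) L))))))))))).

End Plans.

Lemma search5 : search (all_stars 5) [:: shapeS1] 5 [::] [::] plan5.
Proof. by vm_compute. Qed.
Lemma search6 : search (all_stars 6) [:: shapeS2; shapeS3; shapeS4] 6 three_edges [::] plan6.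
Proof. by vm_compute. Qed.
Lemma search7 : search (all_stars 7) [:: shape7a; shape7b; shapeS8] 7 three_edges [::] plan7.
Proof. by vm_compute. Qed.
Lemma search7a : search (all_stars 7) shapes7 7 (yes shape7a) [::] plan7a.
Proof. by vm_compute. Qed.
Lemma search7b : search (all_stars 7) shapes7 7 (yes shape7b) [::] plan7b.
Proof. by vm_compute. Qed.
Lemma search8 : search (local_stars 2) [:: shape8a] 8 three_edges [::] plan8.
Proof. by vm_compute. Qed.
Lemma search8a : search (all_stars 8) [:: shapeS5; shapeS6] 8 (yes shape8a) [::] plan8a.
Proof. by vm_compute. Qed.
Lemma search9 : search (local_stars 3) [:: shapeS13] 9
  three_edges [::] plan9.
Proof. by vm_compute. Qed.

(** * Finite checks on the types *)

(** Each position, repeated as often as its weight says. *)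
Definition blow_up (ws : seq nat) : seq nat :=
  flatten [seq nseq (nth 0 ws p) p | p <- iota 0 (size ws)].

(** The pairs of copies [cs] of positions that are joined by [L]. *)
Definition links L (cs : seq nat) : seq (nat * nat) :=
  [seq x <- pairs (iota 0 (size cs)) | joined L (nth 0 cs x.1) (nth 0 cs x.2)].

(** [A] packs four edges once the weight of [p] is raised. *)
Definition saturating A p : bool :=
  has_matching 4 (links (yes A) (blow_up (wts A) ++ nseq 4 p)).

(** Whatever the free pairs are, [A] does not pack four edges. *)
Definition tight A : bool :=
  let cs := blow_up (wts A) in
  ~~ has_matching 4 [seq x <- pairs (iota 0 (size cs)) |
      (nth 0 cs x.1 != nth 0 cs x.2) &&
      ~~ joined (no A) (nth 0 cs x.1) (nth 0 cs x.2)].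

(** [A] with a vertex outside the support, of weight 0, whose neighbours are the
    positions in [S]. *)
Definition add_vertex A (S : seq nat) : shape :=
  let m := size (wts A) in
  Shape (rcons (wts A) 0) (yes A ++ [seq (q, m) | q <- S])
        (no A ++ [seq (q, m) | q <- iota 0 m & q \notin S]).

(** All sublists of [l]. *)
Fixpoint subseqs (l : seq nat) : seq (seq nat) :=
  if l is p :: l' then [seq p :: u | u <- subseqs l'] ++ subseqs l' else [:: [::]].

(** Four edges can be packed when the weight of an outside vertex is raised, for
    every set of neighbours which satisfies [P]. *)
Definition outside_ok (P : seq nat -> bool) A : bool :=
  all (fun S => if P S then saturating (add_vertex A S) (size (wts A)) else true)
      (subseqs (iota 0 (size (wts A)))).

(** Conversely, [P] holds for the neighbours of an outside vertex at which raising the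
    weight allows to pack four edges. *)
Definition stuck_outside (P : seq nat -> bool) A : bool :=
  let m := size (wts A) in
  all (fun S => if P S then true else stuck (no (add_vertex A S)) (iota 0 m.+1) m)
      (subseqs (iota 0 m)).

Definition inside_ok A : bool := all (saturating A) (iota 0 (size (wts A))).

Lemma filter_subseqs (P : pred nat) l : filter P l \in subseqs l.
Proof.
elim: l => //= p l IH; rewrite mem_cat; case: ifP => _; last by rewrite IH orbT.
by rewrite map_f.
Qed.

Section Realisations.
Variables (T : eqType) (e : rel T) (x0 : T).
Hypotheses (e_sym : ssrbool.symmetric e) (e_irr : irreflexive e).
Implicit Types (vs : seq T) (c : T -> nat).

Local Notation nth := (nth x0).
Local Notation realises := (realises e x0).

Lemma count_blow_up vs ws v :
  count_mem v [seq nth vs p | p <- blow_up ws] = weight_at x0 vs ws v.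
Proof.
rewrite count_map count_flatten -map_comp sumnE big_map /weight_at [RHS]big_mkcond.
by apply: eq_bigr => p _; rewrite /= count_nseq /=; case: (_ == v); rewrite ?mul1n.
Qed.

Lemma links_packs vs L cs : edges (copy_rel e x0 vs) L -> has_matching 4 (links L cs) ->
  packs e (fun v => count_mem v [seq nth vs p | p <- cs]) 4.
Proof.
move=> eL m4; have in_links x : x \in links L cs ->
    [/\ x.1 < size cs, x.2 < size cs, x.1 != x.2 &
        joined L (seq.nth 0 cs x.1) (seq.nth 0 cs x.2)].
  rewrite mem_filter => /andP[jx /pairs_neq]; rewrite iota_uniq !mem_iota.
  by case=> // ? ? ?; split.
have [|s [s4 sl us]] := has_matching_sound m4.
  by apply/allP=> x /in_links[].
rewrite -s4; apply: (@copies_packs _ _ x0) => //.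
  apply/allP=> x /sl/in_links[x1 x2 _]; rewrite /copy_rel !(nth_map 0) //.
  exact: edges_joined.
by move=> p /mem_endsP[x /sl/in_links[x1 x2 _ _] /orP[]/eqP->]; rewrite size_map.
Qed.

Lemma realises_saturating c vs A p : realises c vs A -> saturating A p ->
  packs e (star c (nth vs p)) 4.
Proof.
move=> [sv wv ev nv] /(links_packs ev); apply: packs_le => v.
by rewrite map_cat map_nseq count_cat count_blow_up wv count_nseq /star mulnC eq_sym.
Qed.

Lemma realises_tight c vs A : realises c vs A -> tight A -> ~ packs e c 4.
Proof.
move=> [sv wv ev nv] /negP tA [s [s4 es cs]]; apply: tA.
set cp := blow_up _.
have [|s' [def_s us lts]] := @lift_copies _ x0 [seq nth vs p | p <- cp] s.
  by move=> v; rewrite count_blow_up wv.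
apply: (@has_matching_oriented _ _ s') => //; last by rewrite -s4 def_s size_map.
move=> x xs; have /andP[x1 x2] := mem_ends xs.
have {x1}lt1 := lts _ x1; have {x2}lt2 := lts _ x2; rewrite size_map in lt1 lt2.
have ex : copy_rel e x0 vs (seq.nth 0 cp x.1) (seq.nth 0 cp x.2).
  have := allP es (nth [seq nth vs p | p <- cp] x.1, nth [seq nth vs p | p <- cp] x.2).
  by rewrite def_s (map_f _ xs) !(nth_map 0) // => /(_ isT).
have nx : seq.nth 0 cp x.1 != seq.nth 0 cp x.2.
  by apply: contraTneq ex => ->; rewrite copy_irr.
have nj p q : copy_rel e x0 vs p q -> joined (no A) p q = false.
  by move=> gpq; apply/negP => /(nonedges_joined (copy_sym x0 e_sym vs) nv); rewrite gpq.
have x12 : x.1 != x.2 by apply: contraNneq nx => ->.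
have := mem_pairs (_ : x.1 \in iota 0 (size cp)) (_ : x.2 \in iota 0 (size cp)) x12.
rewrite !mem_iota lt1 lt2 => /(_ isT isT).
rewrite !joinedE !mem_filter /= nx (eq_sym _ (seq.nth 0 cp x.1)) nx.
by rewrite !nj // copy_sym.
Qed.

(** The positions of [vs] which hold a neighbour of [i]. *)
Definition nbr_positions vs i : seq nat :=
  [seq q <- iota 0 (size vs) | e i (nth vs q)].

Lemma nbr_positions_subseqs vs i (ws : seq nat) : size vs = size ws ->
  nbr_positions vs i \in subseqs (iota 0 (size ws)).
Proof. by move=> <-; apply: filter_subseqs. Qed.

Lemma realises_add_vertex c vs A i : well_formed A -> realises c vs A ->
  realises c (rcons vs i) (add_vertex A (nbr_positions vs i)).
Proof.
move=> wfA [sv wv ev nv].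
have ltA x : x \in yes A ++ no A -> (x.1 < size vs) && (x.2 < size vs).
  by rewrite sv; apply: (allP wfA).
have nthl q : q < size vs -> nth (rcons vs i) q = nth vs q by rewrite nth_rcons => ->.
have nthr : nth (rcons vs i) (size vs) = i by rewrite nth_rcons ltnn eqxx.
split; first by rewrite /= !size_rcons sv.
- move=> v; rewrite -wv /weight_at /= size_rcons -addn1 iotaD big_cat /= big_cons big_nil.
  rewrite add0n [seq.nth 0 _ _]nth_rcons ltnn eqxx if_same addn0 -sv.
  rewrite big_seq_cond [RHS]big_seq_cond; apply: eq_big => [q|q /andP[]];
    rewrite ?mem_iota add0n /=; first by apply: andb_id2l => /nthl->.
  by rewrite sv => ltq _; rewrite nth_rcons ltq.
- rewrite /= /edges all_cat; apply/andP; split.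
    apply/allP=> x xA; have /andP[x1 x2] : (x.1 < size vs) && (x.2 < size vs).
      by apply: ltA; rewrite mem_cat xA.
    by rewrite /copy_rel !nthl //; apply: (allP ev).
  apply/allP=> _ /mapP[q + ->]; rewrite mem_filter mem_iota -sv => /andP[eq ltq] /=.
  by rewrite /copy_rel nthl // nthr e_sym.
rewrite /= /nonedges all_cat; apply/andP; split.
  apply/allP=> x xA; have /andP[x1 x2] : (x.1 < size vs) && (x.2 < size vs).
    by apply: ltA; rewrite mem_cat xA orbT.
  by rewrite /copy_rel !nthl //; apply: (allP nv).
apply/allP=> _ /mapP[q + ->]; rewrite !mem_filter -sv !mem_iota => /andP[+ ltq] /=.
by rewrite ?mem_iota ?ltq ?andbT /copy_rel nthl // nthr e_sym.
Qed.

Lemma outside_packs c vs A P i : well_formed A -> outside_ok P A -> realises c vs A ->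
  P (nbr_positions vs i) -> packs e (star c i) 4.
Proof.
move=> wfA oA rA Pi; have [sv _ _ _] := rA.
have := allP oA _ (nbr_positions_subseqs i sv); rewrite Pi => sat.
have := realises_saturating (realises_add_vertex i wfA rA) sat.
by rewrite nth_rcons -sv ltnn eqxx.
Qed.

(** The outside vertex is appended to the list of copies; the additional copy is
    harmless, since its capacity is raised anyway. *)
Lemma outside_stuck c vs A P i : well_formed A -> stuck_outside P A ->
  wts A = nseq (size vs) 1 -> realises c vs A ->
  packs e (star c i) 4 -> P (nbr_positions vs i).
Proof.
move=> wfA oA ones rA pi; have [sv wv _ _] := rA.
have := allP oA _ (nbr_positions_subseqs i sv); case: ifP => // _ st.
have [_ _ _ nv] := realises_add_vertex i wfA rA.
case: (stuck_no_star (copy_sym x0 e_sym _) (copy_irr x0 e_irr _) nv st).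
apply: star_copies; first exact: iota_uniq.
rewrite -sv -(size_rcons vs i) map_nth_iota0 // take_size nth_rcons ltnn eqxx.
apply: packs_le pi => v; rewrite leq_add2r -cats1 count_cat; apply: leq_trans (leq_addr _ _).
by rewrite -wv ones weight_at_ones.
Qed.

End Realisations.

(** The set of neighbours is nonempty and its weight exceeds 7 minus the total weight. *)
Definition heavy_nbrs A (u : seq nat) : bool :=
  (0 < size u) && (7 < sumn [seq nth 0 (wts A) q | q <- u] + sumn (wts A)).

(** Positions 0 to 2 of [shapeS7] form the triangle; two neighbours among the four other
    positions are needed to meet every triangle of the complete graph. *)
Definition meets_triangle_or_K4 (u : seq nat) : bool :=
  has (fun q => q < 3) u || (1 < count (fun q => 2 < q) u).

(** Position 3 of [shapeS12] is the midpoint of the path. *)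
Definition meets_end_triangle (u : seq nat) : bool :=
  has (fun q => q < 3) u || has (fun q => 3 < q) u.

Lemma listed_shapes_ok : all (fun A => [&& well_formed A, inside_ok A, tight A &
  outside_ok (heavy_nbrs A) A]) listed_shapes.
Proof. by vm_compute. Qed.

Lemma shapeS7_ok : [&& well_formed shapeS7, inside_ok shapeS7, tight shapeS7,
  outside_ok meets_triangle_or_K4 shapeS7 & stuck_outside meets_triangle_or_K4 shapeS7].
Proof. by vm_compute. Qed.

Lemma shapeS12_ok : [&& well_formed shapeS12, inside_ok shapeS12, tight shapeS12 &
  outside_ok meets_end_triangle shapeS12].
Proof. by vm_compute. Qed.

Lemma shapeS12_joined_ok :
  well_formed shapeS12_joined && outside_ok (fun u => 0 < size u) shapeS12_joined.
Proof. by vm_compute. Qed.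

Lemma shapeS12_separated_ok :
  well_formed shapeS12_separated && stuck_outside meets_end_triangle shapeS12_separated.
Proof. by vm_compute. Qed.

(** * The combinatorial classification *)

Section Classification.
Variables (T : finType) (G : sgraph T) (x0 : T) (a : T -> nat).

Let G_sym := @adj_sym T G.
Let G_irr := @adj_irr T G.

Local Notation packs := (packs G).
Local Notation realises := (realises G x0).
Local Notation realises_some := (realises_some G x0).
Local Notation copies vs := (fun v => count_mem v vs).

(** The capacities [a] do not pack four edges, but do so when any one of them is
    raised. *)
Definition obstructed : Prop := (forall i, packs (star a i) 4) /\ ~ packs a 4.

(** Every vertex has a neighbour in the support of [a]. *)
Definition dominates : Prop := forall i, exists2 j, 0 < a j & G i j.

(** The three cases of the theorem, in terms of lists of vertices. *)
Definition classified : Prop :=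
  [\/ exists vs, [/\ uniq vs, realises a vs shapeS7 &
        forall i, a i = 0 -> meets_triangle_or_K4 (nbr_positions G x0 vs i)],
      exists vs, [/\ uniq vs, realises a vs shapeS12 &
        G (nth x0 vs 0) (nth x0 vs 4) \/
        forall i, a i = 0 -> meets_end_triangle (nbr_positions G x0 vs i)] |
      realises_some a listed_shapes /\
      forall i, a i = 0 -> 7 < \sum_(v | G i v) a v + \sum_v a v].

(** A raise helps only at a vertex with a neighbour in the support. *)
Lemma star_nbr c i : ~ packs c 4 -> packs (star c i) 4 -> exists2 j, 0 < c j & G i j.
Proof.
move=> no4 [s [s4 es cs]].
have [le|lt] := leqP (count_mem i (ends s)) (c i).
  case: no4; exists s; split=> // v; have := cs v; rewrite /star.
  by have [->|_] := eqVneq v i; rewrite ?muln0 ?addn0.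
have [|j [s1 [eij _ _ cj]]] := pick_edge G_sym es (_ : i \in ends s).
  by rewrite -has_pred1 has_count; apply: leq_ltn_trans lt.
exists j => //; have := cs j; have := edge_neq G_irr eij.
by rewrite /star cj eqxx eq_sym => /negbTE->; rewrite muln0 addn0; case: (c j).
Qed.

Lemma maximum_packing : ~ packs a 4 -> exists k, [/\ k < 4, packs a k & ~ packs a k.+1].
Proof.
move=> no4; have p0 : packs a 0 by exists [::].
have [p3|n3] := packs_dec G a 3; first by exists 3.
have [p2|n2] := packs_dec G a 2; first by exists 2.
have [p1|n1] := packs_dec G a 1; first by exists 1.
by exists 0.
Qed.

(** The copies of the vertices may be listed with the ends of a packing first. *)
Lemma packing_copies k : packs a k -> exists M U,
  [/\ size M = k, edges G M & forall v, count_mem v (ends M ++ U) = a v].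
Proof.
move=> [M [sM eM cM]].
exists M, (flatten [seq nseq (a v - count_mem v (ends M)) v | v <- enum T]); split=> // v.
rewrite count_cat count_flatten -map_comp sumnE big_map big_enum /= (bigD1 v) //=.
rewrite count_nseq /= eqxx mul1n big1 => [|w /negbTE wv]; last by rewrite count_nseq /= wv.
by rewrite addn0 subnKC.
Qed.

Lemma size_copies vs : (forall v, count_mem v vs = a v) -> size vs = \sum_v a v.
Proof. by move=> cvs; rewrite -(sum_count_mem vs); apply: eq_bigr. Qed.

Lemma realises_eq c c' vs A : (forall v, c v = c' v) -> realises c vs A -> realises c' vs A.
Proof. by move=> cc' [sv wv ev nv]; split=> // v; rewrite wv. Qed.

Lemma realises_ones_copies c vs A : realises c vs A -> wts A = nseq (size vs) 1 ->
  forall v, count_mem v vs = c v.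
Proof.
by move=> [_ wv _ _] ones v; rewrite -wv ones weight_at_ones.
Qed.

Lemma sum_realises c vs A (P : pred T) : realises c vs A ->
  \sum_(v | P v) c v = \sum_(p <- iota 0 (size vs) | P (nth x0 vs p)) nth 0 (wts A) p.
Proof.
move=> [sv wv _ _]; under eq_bigr do rewrite -wv /weight_at -sv.
rewrite (exchange_big_dep (fun p => P (nth x0 vs p))) /=; last by move=> v p Pv /eqP->.
apply: eq_bigr => p Pp; rewrite (bigD1 (nth x0 vs p)) ?Pp ?eqxx //=.
by rewrite big1 ?addn0 // => v /andP[/andP[_ /eqP->]]; rewrite eqxx.
Qed.

Lemma realises_support c vs A v : realises c vs A -> 0 < c v ->
  exists2 p, p < size vs & nth x0 vs p = v.
Proof.
move=> [sv wv _ _]; rewrite -wv => cv.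
have [/hasP[p]|/hasPn none] := boolP (has (fun p => nth x0 vs p == v) (iota 0 (size vs))).
  by rewrite mem_iota => /andP[_ ltp] /eqP <-; exists p.
by move: cv; rewrite /weight_at -sv big_seq_cond big1 // => p /andP[/none/negbTE->].
Qed.

Section Obstructed.
Hypothesis ob : obstructed.

Let stars i : packs (star a i) 4. Proof. by case: ob. Qed.
Let no4 : ~ packs a 4. Proof. by case: ob. Qed.

Lemma obstructed_dominates : dominates.
Proof. by move=> i; apply: star_nbr. Qed.

Lemma obstructed_deg i : 7 < \sum_(v | G i v) a v + \sum_v a v.
Proof.
apply: leq_trans (packs_star_leq G_sym G_irr (stars i)) _.
by rewrite addnC leq_add2l [leqRHS](bigD1 i) //= leq_addl.
Qed.

(** A vertex [i] is not its own neighbour, so that [8 <= 2 * (deg - a i)]. *)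
Lemma obstructed_deg5 : 5 <= \sum_v a v.
Proof.
have [i ai _] := obstructed_dominates x0.
have := packs_star_leq G_sym G_irr (stars i).
have : \sum_(v | G i v) a v <= \sum_(v | v != i) a v.
  rewrite [leqLHS]big_mkcond [leqRHS]big_mkcond; apply: leq_sum => v _.
  by have [->|] := eqVneq v i; rewrite ?G_irr //; case: ifP.
rewrite [X in 5 <= X](bigD1 i) //=; move: ai.
set A := (\sum_(v | v != i) a v); set B := (\sum_(v | G i v) a v).
by clear; lia.
Qed.

(** Raising a vertex with an unused copy pays off already inside [M]. *)
Lemma residual_star k M u : size M = k -> edges G M ->
    (forall v, count_mem v (ends M) <= a v) -> ~ packs a k.+1 ->
    count_mem u (ends M) < a u ->
  packs (star (copies (ends M)) u) 4.
Proof.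
move=> sM eM cM maxM ltu; have [N [N4 eN cN]] := stars u.
have [N' [K [sN' eN' cN']]] := exchange G_sym G_irr sM eM cM maxM ltu eN cN.
exists N'; split; rewrite ?sN' // => v; rewrite /star.
have [->|vu] := eqVneq v u; last by have := cN' v; rewrite (negbTE vu) !muln0.
by rewrite -N4 -sN' muln1 (leq_trans (count_ends_le G_irr _ eN')) // leq_addl.
Qed.

(** The search applied to all copies of the vertices. *)
Lemma run_search vs d Bs Y t : search (all_stars d) Bs d Y [::] t ->
    (forall v, count_mem v vs = a v) -> size vs = d ->
    all (fun x => (x.1 < d) && (x.2 < d)) Y -> edges (copy_rel G x0 vs) Y ->
  exists k vs', k < size Bs /\ realises a vs' (nth no_shape Bs k).
Proof.
move=> st cvs sv; subst d => /allP Yd eY.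
have [|||k [vs' [ltk rk]]] := search_sound G_sym G_irr _ _ _ eY (isT : nonedges _ [::]) st.
- by apply: contra_not no4; apply: packs_le => v; rewrite cvs.
- move=> p r /mapP[q]; rewrite mem_iota /= => ltq [-> ->].
  apply: star_copies; first exact: iota_uniq.
  rewrite map_nth_iota0 // take_size; apply: packs_le (stars _) => v.
  by rewrite /star cvs.
- by move=> x /Yd.
by exists k, vs'; split=> //; apply: realises_eq rk.
Qed.

(** If a maximum packing has at most two edges, then it has exactly two and every
    residual copy is adjacent to all four ends; two residual copies would then give
    a packing of three edges. *)
Lemma small_packing_deg k : k < 3 -> packs a k -> ~ packs a k.+1 -> \sum_v a v = 5.
Proof.
move=> ltk /packing_copies[M [U [sM eM cMU]]] maxM.
have sMU := size_copies cMU; have cM v : count_mem v (ends M) <= a v.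
  by rewrite -cMU count_cat leq_addr.
have d5 := obstructed_deg5.
have nbr u : u \in U -> k = 2 /\ forall v, v \in ends M -> G u v.
  move=> uU; have ltu : count_mem u (ends M) < a u.
    by rewrite -cMU count_cat -addn1 leq_add2l -has_count has_pred1.
  have := packs_star_leq G_sym G_irr (residual_star sM eM cM maxM ltu).
  have sE : \sum_v count_mem v (ends M) = k.*2 by rewrite sum_count_mem size_ends sM.
  have le1 : \sum_(v | v != u) count_mem v (ends M) <= k.*2.
    by rewrite -sE [leqRHS](bigD1 u) //= leq_addl.
  have : \sum_(v | G u v) count_mem v (ends M) + \sum_(v | ~~ G u v) count_mem v (ends M) = k.*2.
    by rewrite -sE [RHS](bigID (G u)).
  move=> sumD le8; split; first by move: ltk le1 sumD le8; clear; lia.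
  have /eqP : \sum_(v | ~~ G u v) count_mem v (ends M) = 0.
    by move: ltk le1 sumD le8; clear; lia.
  rewrite sum_nat_eq0 => /forallP no v; rewrite -has_pred1 has_count lt0n.
  by apply: contraNT => nuv; apply: (implyP (no v)).
case: U => [|u [|w U]] in cMU sMU nbr *.
- by move: sMU d5; rewrite cats0 size_ends sM; move: ltk; clear; lia.
- by move: sMU d5; rewrite size_cat size_ends sM /=; move: ltk; clear; lia.
have [k2 Gu] := nbr u (mem_head _ _).
have [_ Gw] : k = 2 /\ forall v, v \in ends M -> G w v by apply: nbr; rewrite !inE eqxx orbT.
(* The two edges [x y], [z t] are replaced by [u x], [w y], [z t]. *)
case: maxM; move: sM eM cMU Gu Gw; rewrite k2.
case: (M) => [|[x y] [|[z t] []]] // _ /and3P[_ Gzt _] cMU Gu Gw.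
exists [:: (u, x); (w, y); (z, t)]; split=> //.
  by rewrite /edges /= Gu ?Gw ?Gzt // !inE eqxx ?orbT.
by move=> v; rewrite -cMU /=; clear; lia.
Qed.

Lemma classified_listed A vs : has (embeds A) listed_shapes -> realises a vs A -> classified.
Proof.
move=> emb rA; constructor 3; split; last by move=> i _; apply: obstructed_deg.
exact: (realises_someI G_sym G_irr listed_shapes_closed emb rA).
Qed.

Lemma classified_shapes7 k vs : k < size shapes7 -> realises a vs (nth no_shape shapes7 k) ->
  classified.
Proof.
have special := all_nthP no_shape special_shapes_closed.
case: k => [|[|[|[|[|[|[|//]]]]]]] _ rk; try by apply: classified_listed rk; vm_compute.
- have [uv|] := realises_uniq G_sym G_irr listed_shapes_closed (special 0 isT) rk; last first.
    by move=> ?; constructor 3; split=> // i _; apply: obstructed_deg.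
  constructor 1; exists vs; split=> // i _; have [sv _ _ _] := rk.
  have /and5P[wf7 _ _ _ st7] := shapeS7_ok.
  by apply: (outside_stuck G_sym G_irr wf7 st7 _ rk); rewrite ?sv.
- have [uv|] := realises_uniq G_sym G_irr listed_shapes_closed (special 1 isT) rk; last first.
    by move=> ?; constructor 3; split=> // i _; apply: obstructed_deg.
  constructor 2; exists vs; have [sv wv /= /andP[G04 ev] _] := rk.
  by split=> //; left.
have [uv|] := realises_uniq G_sym G_irr listed_shapes_closed (special 2 isT) rk; last first.
  by move=> ?; constructor 3; split=> // i _; apply: obstructed_deg.
constructor 2; exists vs; have [sv wv ev _] := rk; split=> //.
right=> i _; have /andP[wf12 st12] := shapeS12_separated_ok.
by apply: (outside_stuck G_sym G_irr wf12 st12 _ rk); rewrite ?sv.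
Qed.

(** The number of copies is 5, or 6 plus the number of residual copies; in the latter
    case there are at most three of these. *)
Lemma obstructed_classified : classified.
Proof.
have [k [ltk pk maxk]] := maximum_packing no4.
have [lt3|ge3] := ltnP k 3.
  have d5 := small_packing_deg lt3 pk maxk.
  have [M [U [_ _ cvs]]] := packing_copies pk; have svs := size_copies cvs.
  have svs5 : size (ends M ++ U) = 5 by rewrite svs.
  have [k' [vs' [ltk' rk']]] := run_search search5 cvs svs5 isT isT.
  by case: k' ltk' rk' => [|//] _ /classified_listed; apply; vm_compute.
have {ltk ge3} k3 : k = 3 by move: ltk ge3; clear; lia.
rewrite {k}k3 in pk maxk; have [M [U [sM eM cvs]]] := packing_copies pk.
have eE W : edges (copy_rel G x0 (ends M ++ W)) three_edges.
  by move: sM eM; case: (M) => [|[x y] [|[z t] [|[u v] []]]].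
have sEM : size (ends M) = 6 by rewrite size_ends sM.
have cM v : count_mem v (ends M) <= a v by rewrite -cvs count_cat leq_addr.
have resid u : u \in U -> packs (star (copies (ends M)) u) 4.
  move=> uU; apply: residual_star sM eM cM maxk _.
  by rewrite -cvs count_cat -addn1 leq_add2l -has_count has_pred1.
have local_search W Bs t : {subset W <= U} -> (forall v, count_mem v (ends M ++ W) <= a v) ->
    search (local_stars (size W)) Bs (6 + size W) three_edges [::] t ->
    exists k vs, k < size Bs /\ realises (copies (ends M ++ W)) vs (nth no_shape Bs k).
  move=> WU cW; rewrite -sEM -size_cat => st.
  apply: (search_sound G_sym G_irr _ _ _ (eE W) (isT : nonedges _ [::]) st).
  - by apply: contra_not no4; apply: packs_le.
  - move=> p r /mapP[q]; rewrite mem_iota => /andP[le6 ltq] [-> ->].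
    apply: (star_copies (r := iota 0 6)) => //.
    have -> : [seq nth x0 (ends M ++ W) q | q <- iota 0 6] = ends M.
      by rewrite map_nth_iota0 ?size_cat ?sEM ?leq_addr // -sEM take_size_cat.
    by apply/resid/WU; rewrite nth_cat sEM ltnNge le6 mem_nth // ltn_subLR.
  by move=> x; rewrite size_cat sEM !inE => /or3P[]/eqP->.
have ones c vs A : realises c vs A -> wts A = nseq (size (wts A)) 1 ->
    (forall v, count_mem v vs = c v) /\ size vs = size (wts A).
  move=> rA oA; have [sv _ _ _] := rA; split=> //.
  by apply: (realises_ones_copies rA); rewrite sv.
case: U => [|u [|v [|w U]]] in cvs resid local_search *.
- have s6 : size (ends M ++ [::]) = 6 by rewrite size_cat sEM.
  have [k [vs [ltk rk]]] := run_search search6 cvs s6 isT (eE _).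
  by case: k ltk rk => [|[|[|//]]] _ /classified_listed; apply; vm_compute.
- have s7 : size (ends M ++ [:: u]) = 7 by rewrite size_cat sEM.
  have [k [vs [ltk rk]]] := run_search search7 cvs s7 isT (eE _).
  case: k ltk rk => [|[|[|//]]] _ rk; last by apply: classified_listed rk; vm_compute.
    have [cv sv] := ones _ _ _ rk erefl; have [_ _ ev _] := rk.
    have [k [vs' [ltk rk']]] := run_search search7a cv sv isT ev.
    exact: classified_shapes7 rk'.
  have [cv sv] := ones _ _ _ rk erefl; have [_ _ ev _] := rk.
  have [k [vs' [ltk rk']]] := run_search search7b cv sv isT ev.
  exact: classified_shapes7 rk'.
- have [//|z|k [vs [ltk rk]]] := local_search [:: u; v] _ _ _ _ search8; first by rewrite cvs.
  case: k ltk rk => [|//] _ rk; have [cv sv] := ones _ _ _ rk erefl; have [_ _ ev _] := rk.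
  have cv' z : count_mem z vs = a z by rewrite cv cvs.
  have [k [vs' [ltk rk']]] := run_search search8a cv' sv isT ev.
  by case: k ltk rk' => [|[|//]] _ /classified_listed; apply; vm_compute.
have [z|z|k [vs [ltk rk]]] := local_search [:: u; v; w] _ _ _ _ search9.
- by rewrite !inE => /or3P[]->; rewrite ?orbT.
- by rewrite -cvs !count_cat /=; clear; lia.
case: k ltk rk => [|//] _ rk; have [cv sv] := ones _ _ _ rk erefl.
(* A tenth copy [t] is adjacent to one of the first nine. *)
case: U => [|t U] in cvs resid local_search *.
  by apply: classified_listed (realises_eq _ rk); [vm_compute | move=> z; rewrite cvs].
have [||j Mj Gtj] := @star_nbr (copies (ends M)) t.
- by apply: contra_not no4; apply: packs_le.
- by apply: resid; rewrite !inE eqxx !orbT.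
have jvs : j \in vs by rewrite -has_pred1 has_count cv count_cat; move: Mj; clear; lia.
have {jvs} [q ltq def_j] : exists2 q, q < 9 & nth x0 vs q = j.
  by exists (index j vs); rewrite ?nth_index // -[9]/(size (wts shapeS13)) -sv index_mem.
have [_ _ ev _] := rk; case: no4.
have m4 : has_matching 4 (yes shapeS13 ++ [:: (q, 9)]).
  by apply: (allP ninth_vertex); rewrite mem_iota.
apply: packs_le (matching_packs G_irr (x0 := x0) (vs := rcons vs t) _ _ m4).
- by move=> z; rewrite -cats1 count_cat cv -cvs !count_cat /=; clear; lia.
- have nthl p : p < 9 -> nth x0 (rcons vs t) p = nth x0 vs p by rewrite nth_rcons sv => ->.
  rewrite /edges all_cat; apply/andP; split; last first.
    by rewrite /= /copy_rel nthl // def_j nth_rcons sv /= G_sym Gtj.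
  apply/allP=> x xY; have /andP[x1 x2] := allP shapeS13_bounded x xY.
  by rewrite /copy_rel !nthl //; apply: (allP ev).
move=> x; rewrite size_rcons sv mem_cat mem_seq1.
case/orP=> [/(allP shapeS13_bounded)/andP[x1 x2]|/eqP->].
  by rewrite !ltnS (ltnW x1) (ltnW x2).
by rewrite /= ltnS ltnW.
Qed.

End Obstructed.

Section Converse.
Hypothesis dom : dominates.

Lemma inside_packs vs A i : inside_ok A -> realises a vs A -> 0 < a i -> packs (star a i) 4.
Proof.
move=> /allP inA rA /(realises_support rA)[p ltp <-]; have [sv _ _ _] := rA.
by apply: (realises_saturating G_sym rA); apply: inA; rewrite mem_iota -sv.
Qed.

Lemma obstructedI vs A P : well_formed A -> inside_ok A -> tight A -> outside_ok P A ->
    realises a vs A -> (forall i, a i = 0 -> P (nbr_positions G x0 vs i)) ->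
  obstructed.
Proof.
move=> wfA inA tA oA rA Pi; split; last exact: (realises_tight G_sym G_irr rA tA).
move=> i; have [ai0|] := posnP (a i); last exact: inside_packs rA.
exact: (outside_packs G_sym wfA oA rA (Pi i ai0)).
Qed.

Lemma nbr_positions_gt0 vs A i : realises a vs A -> 0 < size (nbr_positions G x0 vs i).
Proof.
move=> rA; have [j aj Gij] := dom i; have [p ltp def_j] := realises_support rA aj.
by rewrite size_filter -has_count; apply/hasP; exists p; rewrite ?mem_iota ?def_j.
Qed.

Lemma classified_obstructed : classified -> obstructed.
Proof.
case=> [[vs [_ rA out]]|[vs [_ rA]]|[[k [vs [ltk _ rA]]] out]].
- have /and5P[wfA inA tA oA _] := shapeS7_ok.
  exact: (obstructedI wfA inA tA oA rA out).
- have /and4P[wfA inA tA oA] := shapeS12_ok.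
  (* An edge between the ends of the path makes every outside vertex harmless. *)
  case=> [G04|out]; last exact: (obstructedI wfA inA tA oA rA out).
  have rJ : realises a vs shapeS12_joined.
    have [sv wv ev nv] := rA; split; [exact: sv | exact: wv | | exact: nv].
    by apply/andP; split; [exact: G04 | exact: ev].
  split; last exact: (realises_tight G_sym G_irr rA tA).
  move=> i; have [ai0|] := posnP (a i); last exact: inside_packs rA.
  have /andP[wfJ oJ] := shapeS12_joined_ok.
  exact: (outside_packs G_sym wfJ oJ rJ (nbr_positions_gt0 i rJ)).
have /and4P[wfA inA tA oA] := all_nthP no_shape listed_shapes_ok k ltk.
apply: (obstructedI wfA inA tA oA rA) => i /out; rewrite /heavy_nbrs (nbr_positions_gt0 i rA).
have <- : \sum_v a v = sumn (wts (nth no_shape listed_shapes k)).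
  have [sv _ _ _] := rA; rewrite (sum_realises _ rA) sumnE [RHS](big_nth 0).
  by rewrite /index_iota subn0 sv.
by rewrite (sum_realises _ rA) sumnE big_map big_filter.
Qed.

End Converse.

Theorem obstructed_iff : obstructed <-> dominates /\ classified.
Proof.
split=> [ob|[dom cl]]; last exact: classified_obstructed.
by split; [apply: obstructed_dominates | apply: obstructed_classified].
Qed.

End Classification.

(** * The types as shapes *)

Section Types.
Variables (T : finType) (O : wgraph T) (y0 : T).

(** The distinct vertices [vs] exhaust the weighted graph and satisfy [A]. *)
Definition spanned_by A vs : Prop :=
  [/\ weighted_vertices O vs (wts A), edges (copy_rel O y0 vs) (yes A) &
      nonedges (copy_rel O y0 vs) (no A)].

Definition spanned A : Prop := exists vs, spanned_by A vs.

Fixpoint spanned_some (As : seq shape) : Prop :=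
  if As is A :: As' then spanned A \/ spanned_some As' else False.

Lemma spanned_some_nth As :
  spanned_some As <-> exists2 k, k < size As & spanned (nth no_shape As k).
Proof.
split.
  elim: As => //= A As IH [spA|/IH[k ltk spk]]; first by exists 0.
  by exists k.+1.
by elim: As => [|A As IH] [[|k]] //= ltk spk; [left | right; apply: IH; exists k].
Qed.

Lemma spanned_some_cat As Bs :
  spanned_some (As ++ Bs) <-> spanned_some As \/ spanned_some Bs.
Proof. by elim: As => //=; [tauto | move=> A As ->; tauto]. Qed.

(** A type and its shape state the same adjacencies in different arrangements; the
    tactics below find the list of vertices in the hypothesis on the weights. *)
Ltac solve_bools :=
  unfold edges, nonedges, copy_rel, triangle, separated, allrel in *; simpl in *;
  repeat match goal with H : is_true (_ && _) |- _ => case/andP: H => ? ? end;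
  repeat (apply/andP; split); assumption.

Ltac break :=
  repeat match goal with
  | H : exists _, _ |- _ => destruct H
  | H : _ /\ _ |- _ => destruct H
  | H : and3 _ _ _ |- _ => destruct H
  | H : and4 _ _ _ _ |- _ => destruct H
  | H : and5 _ _ _ _ _ |- _ => destruct H
  | H : _ \/ _ |- _ => destruct H
  | H : False |- _ => destruct H
  | H : or3 _ _ _ |- _ => destruct H
  end.

Ltac shape_from_type :=
  unfold spanned, spanned_by, simple_vertices in *; break;
  match goal with W : weighted_vertices _ ?vs _ |- _ =>
    exists vs; split; [exact W | solve_bools | try done; solve_bools] end.

Ltac one_of_shapes := first [left; shape_from_type | right; one_of_shapes].

Ltac split_goal W :=
  match goal with
  | |- weighted_vertices _ _ _ => exact W
  | |- simple_vertices _ _ => exact W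
  | |- or3 _ _ _ => 
    first [constructor 1; split_goal W | constructor 2; split_goal W | constructor 3; split_goal W]
  | |- _ \/ _ => first [left; split_goal W | right; split_goal W]
  | |- exists _, _ => eexists; split_goal W
  | |- _ /\ _ => split; [split_goal W | split_goal W]
  | |- and3 _ _ _ => split; [split_goal W | split_goal W | split_goal W]
  | |- and4 _ _ _ _ => split; [split_goal W | split_goal W | split_goal W | split_goal W]
  | |- and5 _ _ _ _ _ => split; split_goal W
  | |- _ => solve_bools
  end.

Ltac type_from_shape :=
  unfold spanned, spanned_by in *;
  break;
  match goal with W : weighted_vertices _ ?vs _ |- _ =>
    let u := fresh in let m := fresh in
    case: (W) => u _ m; repeat (destruct vs as [|? vs]; try discriminate m); clear u m;
    split_goal W
  end.

Lemma typeS1P : typeS1 O <-> spanned shapeS1.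
Proof. by rewrite /typeS1; split=> ?; [shape_from_type | type_from_shape]. Qed.

Lemma typeS2P : typeS2 O <-> spanned shapeS2.
Proof. by rewrite /typeS2; split=> ?; [shape_from_type | type_from_shape]. Qed.

Lemma typeS3P : typeS3 O <-> spanned shapeS3.
Proof. by rewrite /typeS3; split=> ?; [shape_from_type | type_from_shape]. Qed.

Lemma typeS4P : typeS4 O <-> spanned shapeS4.
Proof. by rewrite /typeS4; split=> ?; [shape_from_type | type_from_shape]. Qed.

Lemma typeS5P : typeS5 O <-> spanned shapeS5.
Proof. by rewrite /typeS5; split=> ?; [shape_from_type | type_from_shape]. Qed.

Lemma typeS6P : typeS6 O <-> spanned shapeS6.
Proof. by rewrite /typeS6; split=> ?; [shape_from_type | type_from_shape]. Qed.

Lemma typeS8P : typeS8 O <-> spanned shapeS8.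
Proof. by rewrite /typeS8; split=> ?; [shape_from_type | type_from_shape]. Qed.

Lemma typeS9P : typeS9 O <-> spanned shapeS9.
Proof. by rewrite /typeS9; split=> ?; [shape_from_type | type_from_shape]. Qed.

Lemma typeS10P : typeS10 O <-> spanned shapeS10.
Proof. by rewrite /typeS10; split=> ?; [shape_from_type | type_from_shape]. Qed.

Lemma typeS11P : typeS11 O <-> spanned shapeS11.
Proof. by rewrite /typeS11; split=> ?; [shape_from_type | type_from_shape]. Qed.

Lemma typeS13P : typeS13 O <-> spanned shapeS13.
Proof. by rewrite /typeS13; split=> ?; [shape_from_type | type_from_shape]. Qed.

Lemma typeW1P : typeW1 O <-> spanned_some shapesW1.
Proof. by rewrite /typeW1 /=; split=> ?; [break; one_of_shapes | type_from_shape]. Qed.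

Lemma typeW2P : typeW2 O <-> spanned_some shapesW2.
Proof. by rewrite /typeW2 /=; split=> ?; [break; one_of_shapes | type_from_shape]. Qed.

Lemma typeW3P : typeW3 O <-> spanned_some shapesW3.
Proof. by rewrite /typeW3 /=; split=> ?; [break; one_of_shapes | type_from_shape]. Qed.

Lemma typeW4P : typeW4 O <-> spanned_some shapesW4.
Proof. by rewrite /typeW4 /=; split=> ?; [break; one_of_shapes | type_from_shape]. Qed.

Lemma typeW5P : typeW5 O <-> spanned_some shapesW5.
Proof. by rewrite /typeW5 /=; split=> ?; [break; one_of_shapes | type_from_shape]. Qed.

Lemma typeW6P : typeW6 O <-> spanned shapeW6.
Proof. by rewrite /typeW6; split=> ?; [shape_from_type | type_from_shape]. Qed.

Lemma typeW7P : typeW7 O <-> spanned shapeW7.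
Proof. by rewrite /typeW7; split=> ?; [shape_from_type | type_from_shape]. Qed.

Lemma typeW8P : typeW8 O <-> spanned shapeW8.
Proof. by rewrite /typeW8; split=> ?; [shape_from_type | type_from_shape]. Qed.

Lemma typeW9P : typeW9 O <-> spanned shapeW9.
Proof. by rewrite /typeW9; split=> ?; [shape_from_type | type_from_shape]. Qed.

Lemma typeW10P : typeW10 O <-> spanned shapeW10.
Proof. by rewrite /typeW10; split=> ?; [shape_from_type | type_from_shape]. Qed.

Lemma typeS7_onP t1 t2 t3 k1 k2 k3 k4 :
  typeS7_on O t1 t2 t3 k1 k2 k3 k4 <->
  spanned_by shapeS7 [:: t1; t2; t3; k1; k2; k3; k4].
Proof.
rewrite /typeS7_on /spanned_by /simple_vertices; split=> ?; break.
  by split=> //; solve_bools.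
by split=> //; split; solve_bools.
Qed.

Lemma typeS12_onP x x1 x2 m y y1 y2 :
  typeS12_on O x x1 x2 m y y1 y2 <->
  spanned_by shapeS12 [:: x; x1; x2; m; y; y1; y2].
Proof.
rewrite /typeS12_on /spanned_by /simple_vertices; split=> ?; break.
  by split=> //; solve_bools.
by split=> //; split; solve_bools.
Qed.

Lemma listed_typeP :
  other_simple_type O \/ nontrivially_weighted_type O <-> spanned_some listed_shapes.
Proof.
rewrite /other_simple_type /nontrivially_weighted_type /listed_shapes /weighted_shapes.
rewrite !spanned_some_cat typeS1P typeS2P typeS3P typeS4P typeS5P typeS6P typeS8P typeS9P.
rewrite typeS10P typeS11P typeS13P typeW1P typeW2P typeW3P typeW4P typeW5P typeW6P typeW7P.
rewrite typeW8P typeW9P typeW10P [spanned_some simple_shapes]/= [spanned_some [:: _; _; _; _; _]]/=.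
tauto.
Qed.

End Types.

(** * From the support to the whole vertex set *)

Lemma listed_shapes_pos : all (fun A => all (leq 1) (wts A)) listed_shapes.
Proof. by vm_compute. Qed.

Section Support.
Variables (n : nat) (G : sgraph 'I_n) (a : 'X_{1..n}) (y0 : posvertex a).
Local Notation x0 := (val y0).
Local Notation Ga := (induced_wgraph G a).

Lemma weight_at_uniq (T : eqType) (z : T) vs ws p : uniq vs -> size vs = size ws ->
  p < size ws -> weight_at z vs ws (nth z vs p) = nth 0 ws p.
Proof.
move=> uv sv ltp; rewrite /weight_at big_mkcond (bigD1_seq p) ?mem_iota ?iota_uniq //= eqxx.
rewrite big_seq_cond big1 ?addn0 // => q; rewrite mem_iota add0n => /andP[ltq qp].
by rewrite nth_uniq ?sv // (negbTE qp).
Qed.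

Lemma copy_rel_val vs : copy_rel G x0 (map val vs) =2 copy_rel Ga y0 vs.
Proof.
have nv p : nth x0 (map val vs) p = val (nth y0 vs p).
  have [ltp|lep] := ltnP p (size vs); first by rewrite (nth_map y0).
  by rewrite !nth_default ?size_map.
by move=> p q; rewrite /copy_rel !nv.
Qed.

(** A list of vertices of the induced weighted graph that spans it corresponds to a
    list of distinct vertices which distributes the exponents [a]. *)
Lemma spanned_realises A vs : spanned_by Ga y0 A vs ->
  uniq (map val vs) /\ realises G x0 a (map val vs) A.
Proof.
move=> [[uv av wv] ev nv]; have uv' : uniq (map val vs) by rewrite map_inj_uniq //; apply: val_inj.
have sv : size vs = size (wts A) by rewrite -wv size_map.
split=> //; split; rewrite ?size_map //.
- move=> i; have [iv|iv] := boolP (i \in map val vs).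
    have [p ltp def_i] : exists2 p, p < size vs & i = nth x0 (map val vs) p.
      by exists (index i (map val vs)); rewrite ?nth_index // -(size_map val) index_mem.
    by rewrite def_i weight_at_uniq -?sv ?size_map // (nth_map y0) // -wv (nth_map y0).
  rewrite /weight_at big_seq_cond big1 => [|p]; last first.
    rewrite mem_iota -sv => /andP[ltp /eqP def_i]; case/negP: iv.
    by rewrite -def_i mem_nth ?size_map.
  apply/esym/eqP; apply: contraNT iv; rewrite -lt0n => ai.
  have ip : i \in posset a by rewrite inE.
  by rewrite -[i]/(val (Sub i ip : posvertex a)) map_f.
- by apply/allP=> x xY; rewrite copy_rel_val; apply: (allP ev).
by apply/allP=> x xY; rewrite copy_rel_val; apply: (allP nv).
Qed.

Lemma realises_spanned A vs : all (leq 1) (wts A) -> uniq vs -> realises G x0 a vs A ->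
  exists2 vs', vs = map val vs' & spanned_by Ga y0 A vs'.
Proof.
move=> /allP posA uv rA; have [sv wv ev nv] := rA.
have wnth p : p < size vs -> a (nth x0 vs p) = nth 0 (wts A) p.
  by move=> ltp; rewrite -wv weight_at_uniq -?sv.
pose vs' : seq (posvertex a) := pmap insub vs.
have def_vs : map val vs' = vs.
  rewrite (pmap_filter (insubK _)); apply/all_filterP/allP=> v /(nthP x0)[p ltp <-].
  by rewrite isSome_insub inE wnth // posA // mem_nth // -sv.
exists vs' => //; split.
- split.
  + by rewrite -(map_inj_uniq val_inj) def_vs.
  + move=> x; rewrite -(mem_map val_inj) def_vs.
    have ax : 0 < a (val x) by have := valP x; rewrite inE.
    by have [p ltp <-] := realises_support rA ax; apply: mem_nth.
  apply: (@eq_from_nth _ 0); rewrite size_map -(size_map val) def_vs // => p ltp.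
  rewrite -wnth // -def_vs (nth_map y0) ?(nth_map y0) //;
  by rewrite -(size_map val) def_vs.
- by apply/allP=> x xY; rewrite -copy_rel_val def_vs; apply: (allP ev).
by apply/allP=> x xY; rewrite -copy_rel_val def_vs; apply: (allP nv).
Qed.

Lemma listed_realisesP : realises_some G x0 a listed_shapes <->
  other_simple_type Ga \/ nontrivially_weighted_type Ga.
Proof.
rewrite (listed_typeP Ga y0) spanned_some_nth; split.
  move=> [k [vs [ltk uv rk]]]; exists k => //.
  have [vs' _ spk] := realises_spanned (all_nthP no_shape listed_shapes_pos k ltk) uv rk.
  by exists vs'.
by move=> [k ltk [vs /spanned_realises[uv rk]]]; exists k, (map val vs).
Qed.

Lemma outsideP i : reflect (a i = 0) (i \notin posset a).
Proof. by rewrite inE -eqn0Ngt; apply: eqP. Qed.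

Lemma degree_condP i : (7%:Z - (mdeg a)%:Z < (neighbor_deg G a i)%:Z)%R <->
  7 < \sum_(j | G i j) a j + \sum_j a j.
Proof.
have -> : neighbor_deg G a i = \sum_(j | G i j) a j.
  rewrite /neighbor_deg [RHS](bigID (mem (posset a))) /= [X in _ + X]big1 ?addn0.
    by apply: eq_bigl => j; rewrite andbC.
  by move=> j /andP[_ /outsideP].
by rewrite mdegE; lia.
Qed.

Lemma S12_outsideP (vs : seq 'I_n) x x1 x2 m y y1 y2 i : vs = [:: x; x1; x2; m; y; y1; y2] ->
  meets_end_triangle (nbr_positions G x0 vs i) <->
  adjacent_to G i [:: x; x1; x2] \/ adjacent_to G i [:: y; y1; y2].
Proof.
move=> ->; rewrite /meets_end_triangle /nbr_positions !has_count !count_filter.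
rewrite /adjacent_to /= /copy_rel /=.
split=> [H|/orP]; [apply/orP; move: H|];
by case: (G i x); case: (G i x1); case: (G i x2); case: (G i m); case: (G i y);
   case: (G i y1); case: (G i y2).
Qed.

Lemma S7_outsideP t1 t2 t3 k1 k2 k3 k4 i : typeS7_on Ga t1 t2 t3 k1 k2 k3 k4 ->
  meets_triangle_or_K4 (nbr_positions G x0 (map val [:: t1; t2; t3; k1; k2; k3; k4]) i) <->
  adjacent_to G i (map val [:: t1; t2; t3]) \/
  (forall p q r : posvertex a, {subset [:: p; q; r] <= [:: k1; k2; k3; k4]} ->
     triangle Ga p q r -> adjacent_to G i (map val [:: p; q; r])).
Proof.
move=> [_ [_ K4 _]]; rewrite /meets_triangle_or_K4 /nbr_positions has_count !count_filter.
rewrite /adjacent_to /triangle /=.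
have irr (p : posvertex a) : induced_adj G p p = false by apply: adj_irr.
split.
  case/orP=> [|two]; first by
    case: (G i (sval t1)); case: (G i (sval t2)); case: (G i (sval t3)); left.
  right=> p q r sub; have := sub p; have := sub q; have := sub r.
  rewrite !inE !eqxx ?orbT => /(_ isT) ri /(_ isT) qi /(_ isT) pi.
  by case/or4P: pi => /eqP->; case/or4P: qi => /eqP->; case/or4P: ri => /eqP->;
    rewrite /= ?irr ?andbF //= => _; move: two;
    case: (G i (sval k1)); case: (G i (sval k2)); case: (G i (sval k3)); case: (G i (sval k4)).
case=> [|tri].
  by case: (G i (sval t1)); case: (G i (sval t2)); case: (G i (sval t3)).
move: K4; rewrite /= !andbT => /and3P[/and3P[k12 k13 k14] /andP[k23 k24] k34].
have sym (p q : posvertex a) : induced_adj G p q -> induced_adj G q p by rewrite induced_adj_sym.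
have sub p q r : p \in [:: k1; k2; k3; k4] -> q \in [:: k1; k2; k3; k4] ->
    r \in [:: k1; k2; k3; k4] -> {subset [:: p; q; r] <= [:: k1; k2; k3; k4]}.
  by move=> pk qk rk z; rewrite in_cons mem_seq2 => /or3P[]/eqP->.
have T p q r : p \in [:: k1; k2; k3; k4] -> q \in [:: k1; k2; k3; k4] ->
    r \in [:: k1; k2; k3; k4] -> induced_adj G p q -> induced_adj G q r ->
    induced_adj G p r -> [|| G i (sval p), G i (sval q), G i (sval r) | false].
  move=> pk qk rk pq qr pr; apply: tri (sub p q r pk qk rk) _.
  by rewrite pq qr (sym p r pr).
have : [|| G i (sval k1), G i (sval k2), G i (sval k3) | false].
  by apply: T; rewrite ?inE ?eqxx ?orbT.
have : [|| G i (sval k1), G i (sval k2), G i (sval k4) | false].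
  by apply: T; rewrite ?inE ?eqxx ?orbT.
have : [|| G i (sval k1), G i (sval k3), G i (sval k4) | false].
  by apply: T; rewrite ?inE ?eqxx ?orbT.
have : [|| G i (sval k2), G i (sval k3), G i (sval k4) | false].
  by apply: T; rewrite ?inE ?eqxx ?orbT.
by case: (G i (sval k1)); case: (G i (sval k2)); case: (G i (sval k3)); case: (G i (sval k4));
  rewrite ?orbT.
Qed.

End Support.

(** * Powers of the edge ideal and their saturation *)

Section IdealLemmas.
Import GRing.Theory.
Local Open Scope ring_scope.
Variable R : comNzRingType.
Implicit Types (S I : R -> Prop) (p q r : R).

Lemma ideal_span_gen S p : S p -> ideal_span S p.
Proof.
move=> Sp; exists [:: (1, p)]; last by rewrite big_seq1 mul1r.
by move=> c; rewrite inE => /eqP->.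
Qed.

Lemma ideal_spanD S p q : ideal_span S p -> ideal_span S q -> ideal_span S (p + q).
Proof.
move=> [s Ss ->] [t St ->]; exists (s ++ t); last by rewrite big_cat.
by move=> c; rewrite mem_cat => /orP[/Ss|/St].
Qed.

Lemma ideal_spanM S p q : ideal_span S q -> ideal_span S (p * q).
Proof.
move=> [s Ss ->]; exists [seq (p * c.1, c.2) | c <- s].
  by move=> _ /mapP[c cs ->]; apply: (Ss c cs).
by rewrite big_map mulr_sumr; apply: eq_bigr => c _; rewrite mulrA.
Qed.

Lemma ideal_expM I k p q : ideal_exp I k q -> ideal_exp I k (p * q).
Proof. by case: k => //= k; apply: ideal_spanM. Qed.

Lemma ideal_exp_sumP I k (J : Type) (s : seq J) (P : pred J) (F : J -> R) :
  (forall j, P j -> ideal_exp I k (F j)) -> ideal_exp I k (\sum_(j <- s | P j) F j).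
Proof.
move=> IF; elim: s => [|j s IH]; last first.
  rewrite big_cons; case: ifP => // /IF{}IF; case: k IF IH => //= k IF IH.
  by apply: (ideal_spanD IF IH).
by rewrite big_nil; case: k {IF} => //= k; exists [::]; rewrite ?big_nil.
Qed.

Lemma ideal_expS I k p q : I p -> ideal_exp I k q -> ideal_exp I k.+1 (p * q).
Proof. by move=> Ip Iq; apply: ideal_span_gen; exists p, q. Qed.

End IdealLemmas.

Section MonomialIdeals.
Import GRing.Theory.
Local Open Scope ring_scope.
Variables (K : fieldType) (n : nat).
Implicit Types (p q : {mpoly K[n]}) (m : 'X_{1..n}).

(** The supports of the elements of an ideal inherit every property of the
    supports of its generators that passes to multiples of monomials. *)
Lemma msupp_ideal_span (Q : 'X_{1..n} -> Prop) (S : {mpoly K[n]} -> Prop) p m :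
    (forall m1 m2, Q m2 -> Q (m1 + m2)%MM) ->
    (forall q, S q -> forall m', m' \in msupp q -> Q m') ->
  ideal_span S p -> m \in msupp p -> Q m.
Proof.
move=> Qup SQ [s Ss ->]; elim: s Ss => [|c s IH] Ss; first by rewrite big_nil msupp0.
rewrite big_cons => /msuppD_le; rewrite mem_cat => /orP[|]; last first.
  by apply: IH => d ds; apply: Ss; rewrite inE ds orbT.
move/msuppM_le/allpairsP => [[m1 m2] [_ m2c ->]]; apply: Qup.
by apply: SQ m2c; apply: Ss; rewrite mem_head.
Qed.

Lemma msupp_ideal_exp (Q : nat -> 'X_{1..n} -> Prop) (I : {mpoly K[n]} -> Prop) k p m :
    (forall j m1 m2, Q j m2 -> Q j (m1 + m2)%MM) ->
    (forall j m1 m2, Q 1%N m1 -> Q j m2 -> Q j.+1 (m1 + m2)%MM) ->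
    (forall m', Q 0%N m') ->
    (forall q, I q -> forall m', m' \in msupp q -> Q 1%N m') ->
  ideal_exp I k p -> m \in msupp p -> Q k m.
Proof.
move=> Qup Qadd Q0 Q1; elim: k p m => //= k IH p m.
apply: msupp_ideal_span (Qup k.+1) _ => _ [f [g [If Ig ->]]] m'.
move/msuppM_le/allpairsP => [[m1 m2] [m1f m2g ->]]; apply: Qadd; first exact: Q1 m1f.
exact: IH m2g.
Qed.

Variable G : sgraph 'I_n.
Local Notation I := (@edge_ideal K n G).

Let G_sym := @adj_sym _ G.
Let G_irr := @adj_irr _ G.

Lemma packs_mdeg_add k m1 m2 : packs G m2 k -> packs G (m1 + m2)%MM k.
Proof. by apply: packs_le => v; rewrite mnmDE leq_addl. Qed.

Lemma edge_ideal_supp q m : I q -> m \in msupp q -> packs G m 1.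
Proof.
apply: (msupp_ideal_span (Q := fun m => packs G m 1)) => [m1 m2|_ [i [j [Gij ->]]] m'].
  exact: packs_mdeg_add.
rewrite -mpolyXD msuppX inE => /eqP->; exists [:: (i, j)]; split=> //=.
  by rewrite Gij.
by move=> v; rewrite mnmDE !mnm1E !addn0.
Qed.

Lemma packs_add m1 m2 k l : packs G m1 k -> packs G m2 l -> packs G (m1 + m2)%MM (k + l).
Proof.
move=> [s [<- es cs]] [t [<- et ct]]; exists (s ++ t); split; first by rewrite size_cat.
  by rewrite /edges all_cat; apply/andP.
by move=> v; rewrite ends_cat count_cat mnmDE leq_add.
Qed.

Lemma ideal_exp_packs k m : ideal_exp I k 'X_[m] <-> packs G m k.
Proof.
split=> [Im|].
  apply: (msupp_ideal_exp (Q := fun k m => packs G m k) _ _ _ _ Im).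
  - by move=> j m1 m2; apply: packs_mdeg_add.
  - by move=> j m1 m2; apply: packs_add.
  - by move=> m'; exists [::].
  - by move=> q Iq m'; apply: edge_ideal_supp.
  by rewrite msuppX mem_head.
elim: k m => //= k IH m [[|[i j] s] [//= [ss] /andP[Gij es] cs]].
pose m' := (m - (U_(i) + U_(j)))%MM.
have def_m : m = (U_(i) + U_(j) + m')%MM.
  apply/mnmP=> v; rewrite /m' !mnmDE mnmBE mnmDE !mnm1E subnKC //.
  by apply: leq_trans (cs v); rewrite addnA leq_addr.
rewrite def_m !mpolyXD; apply: ideal_expS; first by apply: ideal_span_gen; exists i, j.
apply: IH; exists s; split=> // v; rewrite /m' mnmBE mnmDE !mnm1E.
have le := cs v; rewrite /= addnA in le.
by rewrite leq_subRL // (leq_trans _ le) ?leq_addr.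
Qed.

Lemma irrelevant_expX i k : ideal_exp (@irrelevant_ideal K n) k ('X_i ^+ k).
Proof.
elim: k => //= k IH; rewrite exprS; apply: ideal_expS => //.
by apply: ideal_span_gen; exists i.
Qed.

Lemma irrelevant_exp_supp k q m :
  ideal_exp (@irrelevant_ideal K n) k q -> m \in msupp q -> (k <= mdeg m)%N.
Proof.
apply: (msupp_ideal_exp (Q := fun k m => k <= mdeg m)%N) => [j m1 m2|j m1 m2|//|p].
- by rewrite mdegD => /leq_trans-> //; rewrite leq_addl.
- by rewrite mdegD; apply: leq_add.
move=> Ip m'; move: Ip; apply: (msupp_ideal_span (Q := fun m => 1 <= mdeg m)%N) => [m1 m2|].
  by rewrite mdegD => /leq_trans-> //; rewrite leq_addl.
by move=> _ [i ->] m1; rewrite msuppX inE => /eqP->; rewrite mdeg1.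
Qed.

Lemma saturation_packs m : (0 < n)%N ->
  saturation (ideal_exp I 4) 'X_[m] <-> forall i, packs G (star m i) 4.
Proof.
move=> n_gt0; split=> [[k _ Ik] i|stars].
  have := Ik _ (irrelevant_expX i k); rewrite mpolyXn -mpolyXD.
  case/ideal_exp_packs=> s [s4 es cs]; exists s; split=> // v; rewrite /star.
  have [->|vi] := eqVneq v i.
    by rewrite muln1 -s4 (leq_trans (count_ends_le G_irr _ es)) // leq_addl.
  by have := cs v; rewrite mnmDE mulmnE mnm1E eq_sym (negbTE vi) mul0n muln0.
(* A monomial of degree at least [4 * n] has an exponent which is at least 4. *)
exists (4 * n)%N; first by rewrite muln_gt0.
move=> q Iq; rewrite [q]mpolyE mulr_sumr big_seq.
apply: ideal_exp_sumP => m' m'q.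
rewrite -scalerAr -mpolyXD -mul_mpolyC; apply/ideal_expM/ideal_exp_packs.
have [i mi] : exists i, (4 <= m' i)%N.
  apply/existsP; apply: contraTT (irrelevant_exp_supp Iq m'q) => /existsPn small.
  rewrite -ltnNge mdegE; apply: (@leq_ltn_trans (\sum_(i < n) 3)).
    by apply: leq_sum => i _; rewrite -ltnS ltnNge small.
  by rewrite sum_nat_const card_ord mulnC ltn_pmul2r.
apply: packs_le (stars i) => v; rewrite /star mnmDE leq_add2l.
by have [->|_] := eqVneq v i; rewrite ?muln1 ?muln0.
Qed.

End MonomialIdeals.

(** * The theorem *)

(** Distinct vertices of the support are vertices of the induced weighted graph. *)
Lemma classifiedP (n : nat) (G : sgraph 'I_n) (a : 'X_{1..n}) (y0 : posvertex a) :
  let Ga := induced_wgraph G a in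
  classified G (val y0) a <->
  [\/ exists t1 t2 t3 k1 k2 k3 k4 : posvertex a,
        typeS7_on Ga t1 t2 t3 k1 k2 k3 k4 /\
        (forall i : 'I_n, i \notin posset a ->
           adjacent_to G i (map val [:: t1; t2; t3]) \/
           (forall p q r : posvertex a,
              {subset [:: p; q; r] <= [:: k1; k2; k3; k4]} ->
              triangle Ga p q r ->
              adjacent_to G i (map val [:: p; q; r]))),
      exists x x1 x2 m y y1 y2 : posvertex a,
        typeS12_on Ga x x1 x2 m y y1 y2 /\
        (Ga x y \/
         (forall i : 'I_n, i \notin posset a ->
            adjacent_to G i (map val [:: x; x1; x2]) \/
            adjacent_to G i (map val [:: y; y1; y2]))) |
      (other_simple_type Ga \/ nontrivially_weighted_type Ga) /\
      (forall i : 'I_n, i \notin posset a ->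
         (7%:Z - (mdeg a)%:Z < (neighbor_deg G a i)%:Z)%R)].
Proof.
move=> Ga; split=> [[[vs [uv rS out]]|[vs [uv rS out]]|[li deg]]|[||]].
- have [vs' def_vs sp] := realises_spanned (A := shapeS7) isT uv rS.
  case: (sp) => -[_ _ m _ _]; move: sp out m; rewrite {}def_vs.
  case: vs' => [|t1 [|t2 [|t3 [|k1 [|k2 [|k3 [|k4 [|? ?]]]]]]]] // sp out _.
  have typ := (typeS7_onP Ga y0 t1 t2 t3 k1 k2 k3 k4).2 sp.
  constructor 1; exists t1, t2, t3, k1, k2, k3, k4; split=> // i /outsideP/out.
  by move/(S7_outsideP y0 i typ).
- have [vs' def_vs sp] := realises_spanned (A := shapeS12) isT uv rS.
  case: (sp) => -[_ _ m _ _]; move: sp out m; rewrite {}def_vs.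
  case: vs' => [|x [|x1 [|x2 [|m [|y [|y1 [|y2 [|? ?]]]]]]]] // sp out _.
  have typ := (typeS12_onP Ga y0 x x1 x2 m y y1 y2).2 sp.
  constructor 2; exists x, x1, x2, m, y, y1, y2; split=> //.
  case: out => [Gxy|out]; [by left | right=> i /outsideP/out].
  by move/(S12_outsideP G y0 i erefl).
- constructor 3; split; first exact/(listed_realisesP G y0).
  by move=> i /outsideP/deg/degree_condP.
- move=> [t1 [t2 [t3 [k1 [k2 [k3 [k4 [typ out]]]]]]]].
  have [uv rS] := spanned_realises ((typeS7_onP Ga y0 t1 t2 t3 k1 k2 k3 k4).1 typ).
  constructor 1; exists (map val [:: t1; t2; t3; k1; k2; k3; k4]); split=> // i /outsideP/out.
  by move/(S7_outsideP y0 i typ).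
- move=> [x [x1 [x2 [m [y [y1 [y2 [typ out]]]]]]]].
  have [uv rS] := spanned_realises ((typeS12_onP Ga y0 x x1 x2 m y y1 y2).1 typ).
  constructor 2; exists (map val [:: x; x1; x2; m; y; y1; y2]); split=> //.
  case: out => [Gxy|out]; [by left | right=> i /outsideP/out].
  by move=> adj; apply/(S12_outsideP G y0 i erefl).
move=> [types deg]; constructor 3; split; first exact/(listed_realisesP G y0).
by move=> i /outsideP/deg/degree_condP.
Qed.

Theorem theorem3p1 (K : fieldType) (n : nat) (n_gt0 : (0 < n)%N)
    (G : sgraph 'I_n) (a : 'X_{1..n}) :
  let I4 := ideal_exp (@edge_ideal K n G) 4 in
  let Ga := induced_wgraph G a in
  (saturation I4 ('X_[a])%R /\ ~ I4 ('X_[a])%R)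
  <->
  dominating G (posset a) /\
  [\/ exists t1 t2 t3 k1 k2 k3 k4 : posvertex a,
        typeS7_on Ga t1 t2 t3 k1 k2 k3 k4 /\
        (forall i : 'I_n, i \notin posset a ->
           adjacent_to G i (map val [:: t1; t2; t3]) \/
           (forall p q r : posvertex a,
              {subset [:: p; q; r] <= [:: k1; k2; k3; k4]} ->
              triangle Ga p q r ->
              adjacent_to G i (map val [:: p; q; r]))),
      exists x x1 x2 m y y1 y2 : posvertex a,
        typeS12_on Ga x x1 x2 m y y1 y2 /\
        (Ga x y \/
         (forall i : 'I_n, i \notin posset a ->
            adjacent_to G i (map val [:: x; x1; x2]) \/
            adjacent_to G i (map val [:: y; y1; y2]))) |
      (other_simple_type Ga \/ nontrivially_weighted_type Ga) /\
      (forall i : 'I_n, i \notin posset a ->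
         (7%:Z - (mdeg a)%:Z < (neighbor_deg G a i)%:Z)%R)].
Proof.
move=> I4 Ga; rewrite {}/I4 (saturation_packs K G a n_gt0) (ideal_exp_packs K G 4 a).
have domP : dominating G (posset a) <-> dominates G a.
  by split=> dom i; have [j aj Gij] := dom i; exists j; rewrite // inE in aj *.
have support : dominates G a -> exists _ : posvertex a, True.
  move=> dom; have [j aj _] := dom (Ordinal n_gt0).
  have ja : j \in posset a by rewrite inE.
  by exists (Sub j ja).
rewrite -/(obstructed G a) domP.
split=> [ob|[dom types]].
  have [y0 _] := support (obstructed_dominates ob).
  have [dom cl] := (obstructed_iff G (val y0) a).1 ob.
  by split=> //; apply/(classifiedP G y0).
have [y0 _] := support dom; apply/(obstructed_iff G (val y0) a).
by split=> //; apply/(classifiedP G y0).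
Qed.
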